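(* There are universal constants $c,C,C'>0$ such that the following holds. Let $m\in\mathbb{N}$, let $T$ be a finite nonempty set of $m$-tuples $t=(t_1,\ldots,t_m)$, and for each $t\in T$ let $X_t=(X_{t_1},\ldots,X_{t_m})$ be a tuple of real-valued subgaussian random variables with $X_{t_i}$ defined on a probability space $(\Omega_i,\mathbb{P}_i)$, all considered on the product space $\prod_{i=1}^m(\Omega_i,\mathbb{P}_i)$. Set $$A_t=\frac1m\sum_{i=1}^m\big(X_{t_i}^2-\mathbb{E}X_{t_i}^2\big)\qquad(t\in T).$$ Let $\sigma,K>0$ be constants satisfying $$\sup_{t\in T}\frac1m\sum_{i=1}^m\mathbb{E}\big|X_{t_i}^2-\mathbb{E}X_{t_i}^2\big|^q\leq\frac{q!}{2}\sigma^2K^{q-2}\qquad(q=2,3,\ldots).$$ Then for any $1\leq p<\infty$, $$\Big(\mathbb{E}\sup_{t\in T}|A_t|^p\Big)^{1/p}\leq C'\Big(\frac1m\gamma_{2,p}^2(T,d_{\psi_2})+\frac{1}{\sqrt m}\bar\Delta_{\psi_2}(T)\gamma_{2,p}(T,d_{\psi_2})+\sqrt p\,\frac{\sigma}{\sqrt m}+p\,\frac Km\Big).$$ As a consequence, for all $u\geq 1$, $$\mathbb{P}\Big(\sup_{t\in T}|A_t|\geq C\Big(\frac1m\gamma_2^2(T,d_{\psi_2})+\frac{\bar\Delta_{\psi_2}(T)}{\sqrt m}\gamma_2(T,d_{\psi_2})\Big)+c\Big(\sqrt u\,\frac{\sigma}{\sqrt m}+u\,\frac Km\Big)\Big)\leq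 e^{-u}.$$
   Context: For a random variable $X$, $\|X\|_{\psi_2}=\inf\{a>0:\mathbb{E}\exp(|X|^2/a^2)-1\leq 1\}$; $X$ is subgaussian if $\|X\|_{\psi_2}<\infty$. The semi-metric $d_{\psi_2}$ on $T$ is $d_{\psi_2}(s,t)=\max_{1\leq i\leq m}\|X_{s_i}-X_{t_i}\|_{\psi_2}$ and the associated radius is $\bar\Delta_{\psi_2}(T)=\sup_{t\in T}\max_{1\leq i\leq m}\|X_{t_i}\|_{\psi_2}$. A sequence $\mathcal{T}=(T_n)_{n\geq 0}$ of nonempty subsets of $T$ is admissible if $|T_0|=1$ and $|T_n|\leq 2^{2^n}$ for $n\geq 1$. With $d(t,T_n)=\inf_{s\in T_n}d(t,s)$, set $\gamma_2(T,d)=\inf_{\mathcal{T}}\sup_{t\in T}\sum_{n\geq 0}2^{n/2}d(t,T_n)$ and, for $1\leq p<\infty$ and $l=\lfloor\log_2 p\rfloor$, $\gamma_{2,p}(T,d)=\inf_{\mathcal{T}}\sup_{t\in T}\sum_{n\geq l}2^{n/2}d(t,T_n)$, the infima being over admissible sequences. Powers such as $\gamma_2^2(T,d)$ mean $(\gamma_2(T,d))^2$. *)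

(* Defs.v *)
From HB Require Import structures.
From mathcomp Require Import all_boot all_order all_algebra.
From mathcomp Require Import all_classical all_reals all_analysis.

Set Implicit Arguments.
Unset Strict Implicit.
Unset Printing Implicit Defensive.

Import Order.TTheory GRing.Theory Num.Theory.
Import numFieldNormedType.Exports.

Local Open Scope classical_set_scope.
Local Open Scope card_scope.
Local Open Scope ring_scope.

Definition measure_dprod_display (m : nat) :
  ('I_m -> measure_display) -> measure_display.
Proof. exact: (fun=> default_measure_display). Qed.

(* The library only provides binary products and powers [n.-tuple T]; here the
   factors may differ.  The alias carries the sigma-algebra generated by the
   coordinate maps. *)
Definition dprod (m : nat) (d : 'I_m -> measure_display)
  (Omega : forall i, measurableType (d i)) : Type := forall i, Omega i.

Section dprod_measurable.
Context (m : nat) (d : 'I_m -> measure_display)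
  (Omega : forall i, measurableType (d i)).

HB.instance Definition _ := gen_eqMixin (dprod Omega).
HB.instance Definition _ := gen_choiceMixin (dprod Omega).
HB.instance Definition _ := isPointed.Build (dprod Omega) (fun=> point).

Definition dprod_generators : set (set (dprod Omega)) :=
  [set B | exists i (A : set (Omega i)),
     measurable A /\ B = [set w : dprod Omega | A (w i)]].

HB.instance Definition _ := @isMeasurable.Build (measure_dprod_display d)
  (dprod Omega) <<s dprod_generators >>
  (@sigma_algebra0 _ setT dprod_generators)
  (@sigma_algebraC _ dprod_generators)
  (@sigma_algebra_bigcup _ setT dprod_generators).

End dprod_measurable.

Definition is_product_probability (R : realType) (m : nat)
    (d : 'I_m -> measure_display) (Omega : forall i, measurableType (d i))
    (P : forall i, probability (Omega i) R)
    (Q : probability (dprod Omega) R) : Prop :=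
  forall A : forall i, set (Omega i), (forall i, measurable (A i)) ->
    Q [set w : dprod Omega | forall i, A i (w i)] =
    (\prod_(i < m) P i (A i))%E.

Section dcons.
Context (m : nat) (d : 'I_m.+1 -> measure_display)
  (Omega : forall i, measurableType (d i)).

Let Tail := fun j : 'I_m => Omega (lift ord0 j).

Definition dcons (u : Omega ord0 * dprod Tail) : dprod Omega := fun i =>
  match unliftP ord0 i with
  | UnliftSome j e => ecast k (Omega k) (esym e) (u.2 j)
  | UnliftNone e => ecast k (Omega k) (esym e) u.1
  end.

Lemma dcons0 u : dcons u ord0 = u.1.
Proof.
rewrite /dcons; case: unliftP => [j e|e]; first by move: (neq_lift ord0 j) => /eqP/(_ e).
by rewrite (eq_irrelevance (esym e) erefl).
Qed.

Lemma dcons_lift u j : dcons u (lift ord0 j) = u.2 j.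
Proof.
rewrite /dcons; case: unliftP => [k e|e].
  have jk := lift_inj e; case: _ / jk in e *.
  by rewrite (eq_irrelevance (esym e) erefl).
by move: (neq_lift ord0 j) => /eqP/(_ (esym e)).
Qed.

Lemma measurable_dcons : measurable_fun setT dcons.
Proof.
apply: (@measurability _ _ _ _ _ _ (@dprod_generators _ _ Omega)) => //.
move=> _ [_ [i [A [mA ->]]] <-]; rewrite setTI.
case: (unliftP ord0 i) => [j e|e]; case: _ / (esym e) in A mA *.
  rewrite [X in measurable X](_ : _ = snd @^-1` [set w : dprod Tail | A (w j)]).
    rewrite -[X in measurable X]setTI; apply: measurable_snd => //.
    by apply: sub_sigma_algebra; exists j, A.
  by apply/seteqP; split => u /=; rewrite dcons_lift.
rewrite [X in measurable X](_ : _ = fst @^-1` A).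
  by rewrite -[X in measurable X]setTI; apply: measurable_fst.
by apply/seteqP; split => u /=; rewrite dcons0.
Qed.

HB.instance Definition _ :=
  isMeasurableFun.Build _ _ _ _ dcons measurable_dcons.

End dcons.

Lemma measurable_box (m : nat) (d : 'I_m -> measure_display)
    (Omega : forall i, measurableType (d i)) (A : forall i, set (Omega i)) :
  (forall i, measurable (A i)) ->
  measurable [set w : dprod Omega | forall i, A i (w i)].
Proof.
move=> mA; rewrite [X in measurable X](_ : _ =
    \bigcap_(i in [set: 'I_m]) [set w : dprod Omega | A i (w i)]).
  apply: fin_bigcap_measurable => // i _.
  by apply: sub_sigma_algebra; exists i, (A i).
by apply/seteqP; split => w /= h i; [move=> _|]; exact: h.
Qed.

Lemma product_probability_exists (R : realType) (m : nat)
    (d : 'I_m -> measure_display) (Omega : forall i, measurableType (d i))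
    (P : forall i, probability (Omega i) R) :
  exists Q : probability (dprod Omega) R, is_product_probability P Q.
Proof.
elim: m d Omega P => [|m IH] d Omega P.
  exists (\d_(point : dprod Omega)) => A mA; rewrite big_ord0.
  by rewrite /= diracE mem_set//= => -[].
have [Q' Q'E] := IH _ _ (fun j => P (lift ord0 j)).
pose mu : probability _ R := (P ord0 \x Q')%E.
exists (distribution mu (@dcons _ _ Omega)) => A mA.
rewrite big_ord_recl -Q'E; last by move=> j; exact: mA.
rewrite -product_measure1E//; last first.
  by apply: (@measurable_box _ _ _ (fun j => A (lift ord0 j))) => j; exact: mA.
congr (mu _); apply/seteqP; split => u /=.
  by move=> h; split=> [|j]; [rewrite -dcons0|rewrite -dcons_lift]; exact: h.
move=> [h0 h] i; case: (unliftP ord0 i) => [j ->|->].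
  by rewrite dcons_lift; exact: h.
by rewrite dcons0.
Qed.

(* The rectangles form a pi-system generating the sigma-algebra of [dprod], so
   the measure chosen here is the only one satisfying
   [is_product_probability]. *)
Definition product_probability (R : realType) (m : nat)
    (d : 'I_m -> measure_display) (Omega : forall i, measurableType (d i))
    (P : forall i, probability (Omega i) R) : probability (dprod Omega) R :=
  sval (cid (product_probability_exists P)).

Lemma product_probabilityP (R : realType) (m : nat)
    (d : 'I_m -> measure_display) (Omega : forall i, measurableType (d i))
    (P : forall i, probability (Omega i) R) :
  is_product_probability P (product_probability P).
Proof. exact: (svalP (cid (product_probability_exists P))). Qed.

Definition psi2_norm (R : realType) d (Omega : measurableType d)
    (P : probability Omega R) (X : Omega -> R) : \bar R :=
  ereal_inf [set a%:E | a in [set a : R | 0 < a /\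
    ('E_P[(fun w => expR (`|X w| ^+ 2 / a ^+ 2))%R] - 1 <= 1)%E]].

Definition subgaussian (R : realType) d (Omega : measurableType d)
    (P : probability Omega R) (X : Omega -> R) : Prop :=
  (psi2_norm P X < +oo)%E.

Section gamma.
Context (R : realType) (U : Type).
Implicit Types (T A : set U) (d : U -> U -> \bar R) (Tn : nat -> set U).

Definition set_dist d (t : U) A : \bar R := ereal_inf [set d t s | s in A].

Definition admissible T Tn : Prop :=
  [/\ forall n, Tn n `<=` T, forall n, Tn n !=set0, Tn 0%N #= `I_1 &
      forall n, (1 <= n)%N -> Tn n #<= `I_(2 ^ (2 ^ n))].

Definition gamma2_from (l : nat) T d : \bar R :=
  ereal_inf [set ereal_sup [set
      (\sum_(l <= n <oo) (2 `^ (n%:R / 2))%:E * set_dist d t (Tn n))%E | t in T]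
    | Tn in admissible T].

Definition gamma2 T d : \bar R := gamma2_from 0 T d.

Definition gamma2p (p : R) T d : \bar R :=
  gamma2_from (Num.truncn (ln p / ln 2)) T d.

End gamma.

(* [S i] is the set of possible i-th entries of the index tuples, so that
   [X i (t i)] is the variable written X_{t_i}. *)
Section process.
Context (R : realType) (m : nat) (d : 'I_m -> measure_display)
  (Omega : forall i, measurableType (d i))
  (P : forall i, probability (Omega i) R)
  (S : 'I_m -> Type) (X : forall i, S i -> {RV (P i) >-> R}).
Implicit Types (s t : forall i, S i) (T : set (forall i, S i)).

(* The base point -oo is neutral for the maximum. *)
Definition d_psi2 s t : \bar R :=
  \big[maxe/-oo%E]_(i < m)
    psi2_norm (P i) (fun w => X (s i) w - X (t i) w).

Definition radius_psi2 T : \bar R :=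
  ereal_sup [set \big[maxe/-oo%E]_(i < m) psi2_norm (P i) (X (t i)) | t in T].

(* [fine] loses nothing on subgaussian variables: their second moment is
   finite. *)
Definition centered_square i (x : S i) (w : Omega i) : R :=
  (X x w) ^+ 2 - fine 'E_(P i)[(fun w' => (X x w') ^+ 2)].

Definition avg_centered_square t (w : dprod Omega) : R :=
  m%:R^-1 * \sum_(i < m) centered_square (t i) (w i).

Definition avg_moment (q : nat) t : \bar R :=
  ((m%:R^-1)%:E *
   \sum_(i < m) 'E_(P i)[(fun w => `|centered_square (t i) w| ^+ q)%R])%E.

End process.

(* Main.v *)
(* Chaining at levels n >= l = floor(log2 p).  A link from level n to level n+1
   is estimated in L^q with q = 2^(n+3), so that a union bound over the at most
   2^(3 * 2^n) links of the level costs only a constant factor.  As long as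
   q <= m, the increment of A is a sum of centered subexponential variables in
   its subgaussian regime (Bernstein), of size Delta d 2^(n/2) / sqrt m.  For
   q > m one leaves A and follows instead the empirical L^2 norm of the
   increment of X, whose L^q norm is at most d 2^(n/2) / sqrt m; since A is the
   square of an empirical norm up to its mean, such a distance a changes A by at
   most a constant times a^2 + a Delta, up to a multiple of the value of |A| at
   the point where the regime changes.  The first points of the chains, at most
   2^p of them, are controlled by Bernstein's inequality with parameters sigma
   and K.  All these estimates are collected in one random variable W with
   E W <= 3, in terms of which |A_t|^p is bounded by a deterministic quantity
   times W, simultaneously in t.  The tail bound is Markov's inequality with
   p = u. *)
Require Import Defs.
From mathcomp Require Import all_boot all_order all_algebra.
From mathcomp Require Import all_classical all_reals all_analysis.
From mathcomp Require Import measurable_realfun ring lra.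

Set Implicit Arguments.
Unset Strict Implicit.
Unset Printing Implicit Defensive.

Import Order.TTheory GRing.Theory Num.Theory.
Import numFieldNormedType.Exports.

Local Open Scope classical_set_scope.
Local Open Scope ring_scope.

(** Squares of subgaussian variables are only subexponential. Chaining [A] through all levels would
    therefore add links of weight [2^n] instead of [2^(n/2)], a [gamma_1] functional: in Bernstein's
    bound this is the term [q / m], dominated by [sqrt (q / m)] exactly while [q <= m]. Beyond that
    level the empirical norm helps because it obeys a triangle inequality, and taking the root of
    its square turns the weight back into [2^(n/2)]. Returning to [A] costs a difference of means,
    of order [d Delta]. At the first level with [2^(n+3) > m] the distance [d] to the chain is
    itself at most a constant times [gamma / sqrt m], so this cost is affordable. The psi_2 norm is
    an infimum, not attained for the zero variable. All estimates are thus made at upper bounds of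
    the norms that exceed them by a small slack. The slack disappears at the end into the terms with
    [sigma] and [K], which are strictly positive. *)

(** * Integrals of products of functions of the coordinates *)

Section product_integral.
Context (R : realType).

Lemma measurable_coord (m : nat) (d : 'I_m -> measure_display)
    (Omega : forall i, measurableType (d i)) (i : 'I_m) :
  measurable_fun setT (fun w : dprod Omega => w i).
Proof.
move=> _ B mB; rewrite setTI; apply: sub_sigma_algebra.
by exists i, B.
Qed.

(** This frees later integrals from the particular choice of product measure: an arbitrary [Q] may
    be replaced by the image under [dcons] of a binary product, to which Tonelli applies. *)
Lemma product_probability_unique (m : nat) (d : 'I_m -> measure_display)
    (Omega : forall i, measurableType (d i))
    (P : forall i, probability (Omega i) R)
    (Q1 Q2 : probability (dprod Omega) R) :
  is_product_probability P Q1 -> is_product_probability P Q2 ->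
  forall A, measurable A -> Q1 A = Q2 A.
Proof.
move=> h1 h2.
pose G : set (set (dprod Omega)) :=
  [set B | exists2 A : forall i, set (Omega i), forall i, measurable (A i) &
     B = [set w : dprod Omega | forall i, A i (w i)]].
have GT : G setT.
  exists (fun i => setT) => //; apply/seteqP; split=> w //=.
apply: (@measure_unique _ _ _ G (fun=> setT)) => //.
- apply/seteqP; split.
    apply: smallest_sub; first exact: smallest_sigma_algebra.
    move=> _ [i [A [mA ->]]]; apply: sub_sigma_algebra.
    (* A generator constrains one coordinate; it is the box whose other sides are full. *)
    exists (eqtype.dfwith (fun k => setT : set (Omega k)) A).
      by move=> j; case: eqtype.dfwithP.
    apply/seteqP; split=> w /= h.
      by move=> j; case: eqtype.dfwithP.
    by have := h i; rewrite eqtype.dfwith_in.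
  apply: smallest_sub; first exact: sigma_algebra_measurable.
  by move=> _ [A mA ->]; exact: measurable_box.
- move=> _ _ [A mA ->] [B mB ->]; exists (fun i => A i `&` B i).
    by move=> i; exact: measurableI.
  by apply/seteqP; split=> w /= => [[a b] i|ab]; [|split=> i; case: (ab i)].
- by apply/seteqP; split=> w //= _; exists 0%N.
- by move=> _ [A mA ->]; exact: etrans (h1 _ mA) (esym (h2 _ mA)).
- move=> k; apply: (le_lt_trans (@probability_le1 _ _ _ Q1 setT measurableT)).
  by rewrite ltry.
Qed.

(** Induction on [m], splitting off the first coordinate by Tonelli. Independence enters the
    development only here. With upper bounds [c] in place of the integrals themselves, finiteness of
    every factor comes for free. *)
Lemma le_integral_prod (m : nat) (d : 'I_m -> measure_display)
    (Omega : forall i, measurableType (d i))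
    (P : forall i, probability (Omega i) R)
    (Q : probability (dprod Omega) R)
    (f : forall i, Omega i -> R) (c : 'I_m -> R) :
  is_product_probability P Q ->
  (forall i, measurable_fun setT (f i)) ->
  (forall i w, 0 <= f i w) ->
  (forall i, (\int[P i]_w (f i w)%:E <= (c i)%:E)%E) ->
  (\int[Q]_w (\prod_(i < m) f i (w i))%:E <= (\prod_(i < m) c i)%:E)%E.
Proof.
elim: m d Omega P Q f c => [|m IH] d Omega P Q f c PQ mf f0 fc.
  under eq_integral do rewrite big_ord0.
  rewrite big_ord0 integral_cst// mul1e.
  exact: (@probability_le1 _ _ _ Q setT measurableT).
have c0 i : 0 <= c i.
  by rewrite -lee_fin (le_trans _ (fc i))//; apply: integral_ge0 => w _; rewrite lee_fin.
pose P' := fun j => P (lift ord0 j).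
have [Q' Q'E] := product_probability_exists P'.
pose mu : probability _ R := (P ord0 \x Q')%E.
pose Q2 := distribution mu (@dcons _ _ Omega).
have PQ2 : is_product_probability P Q2.
  move=> A mA; rewrite big_ord_recl -Q'E; last by move=> j; exact: mA.
  rewrite -product_measure1E//; last first.
    by apply: (@measurable_box _ _ _ (fun j => A (lift ord0 j))) => j; exact: mA.
  congr (mu _); apply/seteqP; split => u /=.
    by move=> h; split=> [|j]; [rewrite -dcons0|rewrite -dcons_lift]; exact: h.
  move=> [h0 h] i; case: (unliftP ord0 i) => [j ->|->].
    by rewrite dcons_lift; exact: h.
  by rewrite dcons0.
have mprod n (dd : 'I_n -> measure_display)
    (Om : forall i, measurableType (dd i)) (g : forall i, Om i -> R) :
    (forall i, measurable_fun setT (g i)) ->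
    measurable_fun setT (fun w : dprod Om => (\prod_(i < n) g i (w i))).
  move=> mg; apply: measurable_prod => i _.
  by apply: measurableT_comp; [exact: mg|exact: measurable_coord].
rewrite (eq_measure_integral Q2); last first.
  by move=> A mA _; exact: (product_probability_unique PQ PQ2).
rewrite ge0_integral_distribution; last 2 first.
- by apply/measurable_EFinP; exact: mprod.
- by move=> y; rewrite lee_fin; apply: prodr_ge0 => i _.
pose g (w : dprod (fun j => Omega (lift ord0 j))) :=
  \prod_(j < m) f (lift ord0 j) (w j).
have mg : measurable_fun setT g.
  by apply: (mprod _ _ _ (fun j => f (lift ord0 j))) => i; exact: mf.
have g0 w : 0 <= g w by apply: prodr_ge0 => i _; exact: f0.
under eq_integral => u _.
  rewrite /= big_ord_recl dcons0.
  under eq_bigr do rewrite dcons_lift.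
  rewrite -/(g u.2); over.
rewrite fubini_tonelli1; last 2 first.
- apply/measurable_EFinP; apply: measurable_funM.
    by apply: measurableT_comp; [exact: mf|exact: measurable_fst].
  by apply: measurableT_comp; [exact: mg|exact: measurable_snd].
- by move=> u; rewrite lee_fin mulr_ge0.
rewrite /fubini_F /=.
under eq_integral => u _.
  under eq_integral do rewrite EFinM.
  rewrite ge0_integralZl_EFin//; last 2 first.
  - by move=> ? _; rewrite lee_fin.
  - exact/measurable_EFinP.
  rewrite muleC; over.
have Ig : (\int[Q']_w (g w)%:E <= (\prod_(j < m) c (lift ord0 j))%:E)%E.
  by apply: (IH _ _ P' Q' (fun j => f (lift ord0 j)) (fun j => c (lift ord0 j))).
have Ig0 : (0 <= \int[Q']_w (g w)%:E)%E.
  by apply: integral_ge0 => w _; rewrite lee_fin.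
rewrite -[X in (\int[_]_u (X * _) <= _)%E](@fineK _ (\int[Q']_w (g w)%:E)%E); last first.
  by rewrite ge0_fin_numE// (le_lt_trans Ig)// ltry.
rewrite ge0_integralZl_EFin//; last 3 first.
- by move=> ? _; rewrite lee_fin.
- by apply/measurable_EFinP; exact: mf.
- exact: fine_ge0.
rewrite fineK; last by rewrite ge0_fin_numE// (le_lt_trans Ig)// ltry.
rewrite big_ord_recl mulrC EFinM lee_pmul//.
by apply: integral_ge0 => w _; rewrite lee_fin.
Qed.

End product_integral.

(** * Exponential series and moment generating functions *)

Section exponential_moments.
Context (R : realType).
Implicit Types (x y z : R) (n q : nat).

Lemma expR_ge_fact x n : 0 <= x -> x ^+ n <= n`!%:R * expR x.
Proof.
move=> x0; rewrite mulrC -ler_pdivrMr ?ltr0n ?fact_gt0//.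
apply: (@le_trans _ _ (series (exp_coeff x) n.+1)).
  rewrite /series/= big_nat_recr//= lerDr.
  by apply: sumr_ge0 => i _; exact: exp_coeff_ge0.
apply: nondecreasing_cvgn_le; last exact: is_cvg_series_exp_coeff.
by apply/nondecreasing_seqP => k; rewrite /series/= big_nat_recr//= lerDl exp_coeff_ge0.
Qed.

Lemma norm_expX_le x n : `|x| ^+ n <= n`!%:R * (expR x + expR (- x)).
Proof.
apply: (le_trans (expR_ge_fact n (normr_ge0 x))).
rewrite ler_wpM2l ?ler0n//.
case: (lerP 0 x) => x0; first by rewrite ger0_norm// lerDl expR_ge0.
by rewrite ltr0_norm// lerDr expR_ge0.
Qed.

Lemma nneseries_le_ub (u : nat -> \bar R) (x : \bar R) l :
  (forall n, 0 <= u n)%E -> (forall n, \sum_(l <= i < n) u i <= x)%E ->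
  (\sum_(l <= i <oo) u i <= x)%E.
Proof.
move=> u0 ux; apply: lime_le; last by apply: nearW => n; exact: ux.
by apply: is_cvg_nneseries => n _ _; exact: u0.
Qed.

(** The first two terms keep their sign, so that a centered variable loses the linear one under the
    integral. The series is taken in the extended reals, which avoids any discussion of
    convergence. *)
Lemma expR_le_tail z : ((expR z)%:E <=
  (1 + z)%:E + \sum_(0 <= q <oo) (`|z| ^+ q.+2 / q.+2`!%:R)%:E)%E.
Proof.
set s := (X in (_ + X)%E).
have t0 q : (0 <= (`|z| ^+ q.+2 / q.+2`!%:R)%:E :> \bar R)%E.
  by rewrite lee_fin divr_ge0// exprn_ge0.
have s0 : (0 <= s)%E by apply: nneseries_ge0.
case: (eqVneq s +oo%E) => [->|soo]; first by rewrite addey// leey.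
have sE : s = (fine s)%:E by rewrite fineK// ge0_fin_numE// lt_neqAle soo leey.
rewrite sE -EFinD lee_fin; apply: limr_le; first exact: is_cvg_series_exp_coeff.
exists 2%N => // -[//|[//|n]] _ /=.
rewrite /series/= big_nat_recl// big_nat_recl//=.
rewrite /exp_coeff/= !fact0 expr0 expr1 !divr1 addrA lerD2l.
rewrite -lee_fin -sE; apply: (@le_trans _ _
  (\sum_(0 <= q < n) (`|z| ^+ q.+2 / q.+2`!%:R)%:E)%E).
  rewrite sumEFin lee_fin; apply: ler_sum => q _.
  by rewrite ler_wpM2r// -normrX ler_norm.
by apply: nneseries_lim_ge.
Qed.

Section one_variable.
Context d (Omega : measurableType d) (P : probability Omega R).
Implicit Types (Z : Omega -> R).

Lemma measurable_normX Z n : measurable_fun setT Z ->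
  measurable_fun setT (fun w => `|Z w| ^+ n).
Proof.
by move=> mZ; apply: measurable_funX; apply: measurableT_comp mZ.
Qed.

Lemma mgf_le_moments Z lam : measurable_fun setT Z ->
  P.-integrable setT (EFin \o Z) -> (\int[P]_w (Z w)%:E = 0)%E ->
  (\int[P]_w (expR (lam * Z w))%:E <= 1 +
   \sum_(0 <= q <oo) ((`|lam| ^+ q.+2 / q.+2`!%:R)%:E
     * \int[P]_w (`|Z w| ^+ q.+2)%:E))%E.
Proof.
move=> mZ iZ Z0.
pose f q (w : Omega) : \bar R := (`|lam * Z w| ^+ q.+2 / q.+2`!%:R)%:E.
have mf q : measurable_fun setT (f q).
  apply/measurable_EFinP; apply: measurable_funM; last exact: measurable_cst.
  by apply: measurable_normX; apply: measurable_funM => //; exact: measurable_cst.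
have f0 q w : (0 <= f q w)%E by rewrite lee_fin divr_ge0// exprn_ge0.
have fE q : (\int[P]_w f q w =
    (`|lam| ^+ q.+2 / q.+2`!%:R)%:E * \int[P]_w (`|Z w| ^+ q.+2)%:E)%E.
  rewrite -ge0_integralZl_EFin//.
  - by apply: eq_integral => w _; rewrite /f normrM exprMn mulrAC EFinM.
  - by apply/measurable_EFinP; exact: measurable_normX.
under eq_eseriesr do rewrite -fE.
rewrite -integral_nneseries//.
set g := fun w => (\sum_(0 <= q <oo) f q w)%E.
have g0 w : (0 <= g w)%E by apply: nneseries_ge0.
have mg : measurable_fun setT g.
  by apply: (ge0_emeasurable_sum (P := xpredT)) => // k w _ _; exact: f0.
(* If the moment series diverges the bound is [+oo]. Otherwise [g] is integrable, as is needed to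
   add it to the signed function [1 + lam * Z]. *)
have [->|Ioo] := eqVneq (\int[P]_w g w)%E +oo%E; first by rewrite addey// leey.
have ig : P.-integrable setT g.
  apply/integrableP; split => //.
  under eq_integral do rewrite gee0_abs//.
  by rewrite lt_neqAle Ioo leey.
have i1 : P.-integrable setT (fun w => (1 + lam * Z w)%:E).
  rewrite (_ : (fun w => _) = ((fun=> 1%:E) \+ (fun w => lam%:E * (Z w)%:E))%E).
    apply: integrableD => //; first exact: finite_measure_integrable_cst.
    exact: integrableZl.
  by apply/funext => w; rewrite /= EFinD EFinM.
have -> : (1 = \int[P]_w (1 + lam * Z w)%:E :> \bar R)%E.
  under eq_integral do rewrite EFinD EFinM.
  rewrite integralD//; last 2 first.
  - exact: finite_measure_integrable_cst.
  - exact: integrableZl.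
  rewrite integralZl// Z0 mule0 adde0 integral_cst// mul1e.
  exact: esym (@probability_setT _ _ _ P).
rewrite -integralD//; apply: ge0_le_integral => //.
- apply/measurable_EFinP; apply: measurableT_comp => //.
  by apply: measurable_funM => //; exact: measurable_cst.
- apply: emeasurable_funD => //.
  by case/integrableP: i1.
- by move=> w _; exact: expR_le_tail.
Qed.

End one_variable.

Lemma fact_le_exp n : (n`! <= n ^ n)%N.
Proof.
elim: n => // n IH; rewrite factS expnS leq_mul2l/=.
apply: (leq_trans IH); case: n {IH} => // n.
by rewrite leq_exp2r.
Qed.

Lemma sum_half_le n : \sum_(0 <= q < n) (2^-1 : R) ^+ q <= 2.
Proof.
have -> : \sum_(0 <= q < n) (2^-1 : R) ^+ q = 2 - 2 * 2^-1 ^+ n.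
  elim: n => [|n IH]; first by rewrite big_nil expr0; lra.
  by rewrite big_nat_recr//= IH exprS; lra.
by rewrite gerBl mulr_ge0// exprn_ge0.
Qed.

(** The factorials cancel, which leaves [v / 2 * lam ^+ 2] times a geometric series of ratio
    [lam * K], at most one half; its sum is at most 2. *)
Lemma nneseries_mgf_le (u : nat -> \bar R) (lam v K : R) :
  0 < lam -> 0 <= v -> 0 <= K -> lam * K <= 2^-1 ->
  (forall q, 0 <= u q)%E ->
  (forall q, u q <= (q.+2`!%:R / 2 * v * K ^+ q)%:E)%E ->
  (\sum_(0 <= q <oo) ((lam ^+ q.+2 / q.+2`!%:R)%:E * u q) <=
   (v * lam ^+ 2)%:E)%E.
Proof.
move=> lam0 v0 K0 lK u0 uK.
have c0 q : 0 <= lam ^+ q.+2 / q.+2`!%:R.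
  by rewrite divr_ge0// exprn_ge0// ltW.
apply: nneseries_le_ub => [q|n]; first by rewrite mule_ge0// lee_fin.
apply: (@le_trans _ _ (\sum_(0 <= q < n) (v / 2 * lam ^+ 2 * 2^-1 ^+ q)%:E)%E).
  apply: lee_sum => q _.
  apply: (le_trans (lee_wpmul2l _ (uK q))); first by rewrite lee_fin.
  rewrite -EFinM lee_fin.
  have -> : lam ^+ q.+2 / q.+2`!%:R * (q.+2`!%:R / 2 * v * K ^+ q) =
      v / 2 * lam ^+ 2 * (lam * K) ^+ q.
    have : q.+2`!%:R != 0 :> R by rewrite pnatr_eq0 -lt0n fact_gt0.
    rewrite exprMn -addn2 exprD => h; field.
    exact: h.
  apply: ler_wpM2l; first by rewrite mulr_ge0 ?sqr_ge0// divr_ge0.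
  by apply: lerXn2r => //; rewrite nnegrE// mulr_ge0// ltW.
rewrite sumEFin lee_fin -mulr_sumr.
have -> : v * lam ^+ 2 = v / 2 * lam ^+ 2 * 2 by field.
by apply: ler_wpM2l (sum_half_le n); rewrite mulr_ge0 ?sqr_ge0// divr_ge0.
Qed.

End exponential_moments.

(** * Moment bounds for sums of independent variables *)

Section moments_of_sums.
Context (R : realType) (m : nat) (d : 'I_m -> measure_display)
  (Omega : forall i, measurableType (d i))
  (P : forall i, probability (Omega i) R)
  (Q : probability (dprod Omega) R).
Hypothesis PQ : is_product_probability P Q.

Lemma measurable_sum_coord (Z : forall i, Omega i -> R) :
  (forall i, measurable_fun setT (Z i)) ->
  measurable_fun setT (fun w : dprod Omega => \sum_(i < m) Z i (w i)).
Proof.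
move=> mZ; apply: measurable_sum => i.
by apply: measurableT_comp; [exact: mZ|exact: measurable_coord].
Qed.

(** Bernstein's condition is assumed only for the sum over [i], as in the theorem. This is enough
    because the product of the factors [1 + x i] is at most the exponential of the sum of the [x i].
    The sign of [lam] is left free to serve both tails. *)
Lemma mgf_sum_le (Z : forall i, Omega i -> R) (v K lam : R) :
  (forall i, measurable_fun setT (Z i)) ->
  (forall i, (P i).-integrable setT (EFin \o Z i)) ->
  (forall i, \int[P i]_w (Z i w)%:E = 0)%E ->
  0 <= v -> 0 <= K -> lam != 0 -> `|lam| * K <= 2^-1 ->
  (forall q, \sum_(i < m) \int[P i]_w (`|Z i w| ^+ q.+2)%:E <=
     (q.+2`!%:R / 2 * v * K ^+ q)%:E)%E ->
  (\int[Q]_w (expR (lam * \sum_(i < m) Z i (w i)))%:E <=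
    (expR (v * lam ^+ 2))%:E)%E.
Proof.
move=> mZ iZ Z0 v0 K0 lam0 lamK mom.
pose x i := (\sum_(0 <= q <oo) ((`|lam| ^+ q.+2 / q.+2`!%:R)%:E
     * \int[P i]_w (`|Z i w| ^+ q.+2)%:E))%E.
have I0 i q : (0 <= \int[P i]_w (`|Z i w| ^+ q.+2)%:E)%E.
  by apply: integral_ge0 => w _; rewrite lee_fin exprn_ge0.
have t0 i q : (0 <= (`|lam| ^+ q.+2 / q.+2`!%:R)%:E
     * \int[P i]_w (`|Z i w| ^+ q.+2)%:E)%E.
  by rewrite mule_ge0// lee_fin divr_ge0// exprn_ge0.
have x0 i : (0 <= x i)%E by apply: nneseries_ge0 => q _ _; exact: t0.
have sx : (\sum_(i < m) x i <= (v * lam ^+ 2)%:E)%E.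
  rewrite -nneseries_sum; last by move=> i j _; exact: t0.
  rewrite -[lam ^+ 2]real_normK ?num_real//.
  rewrite -/(`|lam| ^+ 2).
  under eq_eseriesr => q _.
    rewrite -ge0_sume_distrr; last by move=> i _; exact: I0.
    over.
  apply: (nneseries_mgf_le _ v0 K0 lamK) mom; first by rewrite normr_gt0.
  by move=> q; apply: sume_ge0 => i _; exact: I0.
have xfin i : x i \is a fin_num.
  rewrite ge0_fin_numE// (le_lt_trans _ (ltry (v * lam ^+ 2)))//.
  apply: le_trans sx; rewrite (bigD1 i)//= leeDl//.
  by apply: sume_ge0 => j _; exact: x0.
apply: (@le_trans _ _ (\prod_(i < m) (1 + fine (x i)))%:E); last first.
  rewrite lee_fin; apply: (@le_trans _ _ (\prod_(i < m) expR (fine (x i)))).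
    apply: ler_prod => i _; rewrite expR_ge1Dx andbT.
    by rewrite addr_ge0// fine_ge0.
  rewrite -expR_sum ler_expR -lee_fin (le_trans _ sx)// -sumEFin.
  by apply: lee_sum => i _; rewrite fineK.
under eq_integral do rewrite mulr_sumr expR_sum.
apply: (le_integral_prod (f := fun i w => expR (lam * Z i w)) PQ).
- move=> i; apply: measurableT_comp => //.
  by apply: measurable_funM => //; exact: measurable_cst.
- by move=> i w; exact: expR_ge0.
- move=> i; rewrite EFinD fineK//.
  exact: (mgf_le_moments lam (mZ i) (iZ i) (Z0 i)).
Qed.

Lemma expR1_le4 : expR 1 <= 4 :> R.
Proof.
have h : 2^-1 <= expR (- 2^-1) :> R.
  by apply: le_trans (expR_ge1Dx _); lra.
have -> : 1 = 2^-1 + 2^-1 :> R by lra.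
rewrite expRD; have : expR 2^-1 <= 2 :> R.
  by rewrite -[leLHS]invrK -expRN invf_ple ?posrE ?expR_gt0// invf_ple ?posrE ?expR_gt0// invrK.
by have := expR_gt0 (2^-1 : R); nra.
Qed.

(** No integration of tails: [|x|^q] is at most [q! (e^x + e^-x)], applied at [x = S / r], where [S]
    is the sum and [q r] is the bracket of the conclusion. *)
Lemma bernstein_moment (Z : forall i, Omega i -> R) (v K : R) (q : nat) :
  (forall i, measurable_fun setT (Z i)) ->
  (forall i, (P i).-integrable setT (EFin \o Z i)) ->
  (forall i, \int[P i]_w (Z i w)%:E = 0)%E ->
  0 < v -> 0 < K -> (0 < q)%N ->
  (forall k, \sum_(i < m) \int[P i]_w (`|Z i w| ^+ k.+2)%:E <=
     (k.+2`!%:R / 2 * v * K ^+ k)%:E)%E ->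
  (\int[Q]_w (`|\sum_(i < m) Z i (w i)| ^+ q)%:E <=
    ((8 * (Num.sqrt (q%:R * v) + 2 * q%:R * K)) ^+ q)%:E)%E.
Proof.
move=> mZ iZ Z0 v0 K0 q0 mom.
have q0R : 0 < q%:R :> R by rewrite ltr0n.
(* The second summand gives [lam * K <= 1/2], the first gives [v * lam ^+ 2 <= q], so that each
   exponential moment is at most [e^q]. *)
pose r := Num.sqrt (v / q%:R) + 2 * K.
have r0 : 0 < r by rewrite ltr_pwDr ?mulr_gt0.
pose lam := r^-1.
have lam0 : 0 < lam by rewrite invr_gt0.
have lamK : lam * K <= 2^-1.
  rewrite /lam mulrC ler_pdivrMr//.
  by have := sqrtr_ge0 (v / q%:R); rewrite /r; lra.
have vlam : v * lam ^+ 2 <= q%:R.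
  have h : v / q%:R <= r ^+ 2.
    rewrite -[v / q%:R]sqr_sqrtr ?divr_ge0 ?(ltW v0) ?(ltW q0R)//.
    rewrite ler_pXn2r ?nnegrE ?sqrtr_ge0 ?(ltW r0)//.
    by rewrite /r lerDl mulr_ge0// ltW.
  rewrite /lam exprVn ler_pdivrMr ?exprn_gt0//.
  by rewrite mulrC -ler_pdivrMr.
have mS : measurable_fun setT (fun w : dprod Omega => \sum_(i < m) Z i (w i)).
  exact: measurable_sum_coord.
have me (a : R) : measurable_fun setT
    (fun w : dprod Omega => expR (a * \sum_(i < m) Z i (w i))).
  by apply: measurableT_comp => //; apply: measurable_funM => //; exact: measurable_cst.
pose c := q`!%:R * r ^+ q.
have c0 : 0 <= c by rewrite mulr_ge0// exprn_ge0// ltW.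
apply: (@le_trans _ _ (\int[Q]_w (c%:E * ((expR (lam * \sum_(i < m) Z i (w i)))%:E
   + (expR (- lam * \sum_(i < m) Z i (w i)))%:E)))%E).
  apply: ge0_le_integral => //.
  - by apply/measurable_EFinP; apply: measurable_normX.
  - apply: emeasurable_funM; first exact: measurable_cst.
    by apply: emeasurable_funD; apply/measurable_EFinP.
  - move=> w _; rewrite -EFinD -EFinM lee_fin.
    have := norm_expX_le (lam * \sum_(i < m) Z i (w i)) q.
    rewrite normrM exprMn gtr0_norm// -mulNr => h.
    rewrite /c mulrAC mulrC -ler_pdivrMl ?exprn_gt0//.
    by rewrite -exprVn.
rewrite ge0_integralZl_EFin//; last 2 first.
- by move=> w _; rewrite adde_ge0// lee_fin expR_ge0.
- by apply: emeasurable_funD; apply/measurable_EFinP.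
rewrite ge0_integralD//; try by apply/measurable_EFinP.
have h1 : (\int[Q]_w (expR (lam * \sum_(i < m) Z i (w i)))%:E <= (expR q%:R)%:E)%E.
  apply: le_trans (mgf_sum_le mZ iZ Z0 (ltW v0) (ltW K0) _ _ mom) _.
  - by rewrite gt_eqF.
  - by rewrite gtr0_norm.
  - by rewrite lee_fin ler_expR.
have h2 : (\int[Q]_w (expR (- lam * \sum_(i < m) Z i (w i)))%:E <= (expR q%:R)%:E)%E.
  apply: le_trans (mgf_sum_le mZ iZ Z0 (ltW v0) (ltW K0) _ _ mom) _.
  - by rewrite oppr_eq0 gt_eqF.
  - by rewrite normrN gtr0_norm.
  - by rewrite sqrrN lee_fin ler_expR.
apply: (le_trans (lee_wpmul2l _ (leeD h1 h2))); first by rewrite lee_fin.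
rewrite -EFinD -EFinM lee_fin.
have -> : expR q%:R = expR 1 ^+ q :> R by rewrite -expRM_natr mul1r.
have -> : Num.sqrt (q%:R * v) + 2 * q%:R * K = q%:R * r.
  have -> : q%:R * v = q%:R ^+ 2 * (v / q%:R) by field; rewrite gt_eqF.
  by rewrite sqrtrM ?sqr_ge0// sqrtr_sqr gtr0_norm// /r; ring.
(* The factor 4 dominates [e]; since [q > 0], the factor [2 ^+ q] absorbs the sum of the two
   exponentials. *)
have -> : 8 * (q%:R * r) = q%:R * r * (2 * 4) by ring.
rewrite !exprMn /c.
have fq : q`!%:R <= q%:R ^+ q :> R by rewrite -natrX ler_nat fact_le_exp.
have e4 : expR 1 ^+ q <= 4 ^+ q :> R.
  by apply: lerXn2r; rewrite ?nnegrE ?expR_ge0 ?expR1_le4.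
have t2 : 2 <= 2 ^+ q :> R.
  case: q q0 {q0R r r0 lam lam0 lamK vlam mS me c c0 h1 h2 fq e4} => // n _.
  by rewrite exprS ler_peMr// exprn_ege1// ler1n.
apply: ler_pM; first exact: c0.
- by rewrite addr_ge0// exprn_ge0// expR_ge0.
- by rewrite ler_wpM2r// exprn_ge0// ltW.
have -> : expR 1 ^+ q + expR 1 ^+ q = 2 * expR 1 ^+ q :> R by ring.
exact: (ler_pM _ _ t2 e4).
Qed.

Lemma square_sum_moment (Y : forall i, Omega i -> R) (a : R) (k : nat) :
  0 < a -> (m <= k)%N ->
  (forall i, measurable_fun setT (Y i)) ->
  (forall i, \int[P i]_w (expR (Y i w ^+ 2 / a ^+ 2))%:E <= 2%:E)%E ->
  (\int[Q]_w ((\sum_(i < m) Y i (w i) ^+ 2) ^+ k)%:E <=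
    ((2 * k%:R * a ^+ 2) ^+ k)%:E)%E.
Proof.
move=> a0 mk mY hY.
have a20 : 0 < a ^+ 2 by rewrite exprn_gt0.
have S0 (w : dprod Omega) : 0 <= \sum_(i < m) Y i (w i) ^+ 2.
  by apply: sumr_ge0 => i _; exact: sqr_ge0.
pose c := k`!%:R * (a ^+ 2) ^+ k.
have c0 : 0 <= c by rewrite mulr_ge0// exprn_ge0// ltW.
have mS : measurable_fun setT (fun w : dprod Omega => \sum_(i < m) Y i (w i) ^+ 2).
  apply: (measurable_sum_coord (Z := fun i w => Y i w ^+ 2)) => i.
  exact: measurable_funX.
have me : measurable_fun setT (fun w : dprod Omega =>
     expR ((a ^+ 2)^-1 * \sum_(i < m) Y i (w i) ^+ 2)).
  by apply: measurableT_comp => //; apply: measurable_funM => //; exact: measurable_cst.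
apply: (@le_trans _ _ (\int[Q]_w
    (c%:E * (expR ((a ^+ 2)^-1 * \sum_(i < m) Y i (w i) ^+ 2))%:E))%E).
  apply: ge0_le_integral => //.
  - by move=> w _; rewrite lee_fin exprn_ge0.
  - by apply/measurable_EFinP; apply: measurable_funX.
  - by apply: emeasurable_funM; [exact: measurable_cst|apply/measurable_EFinP].
  - move=> w _; rewrite -EFinM lee_fin.
    have := @expR_ge_fact _ ((a ^+ 2)^-1 * \sum_(i < m) Y i (w i) ^+ 2) k.
    rewrite exprMn => /(_ _) h.
    rewrite /c mulrAC mulrC -ler_pdivrMl ?exprn_gt0//.
    by rewrite -exprVn h// mulr_ge0// invr_ge0 ltW.
rewrite ge0_integralZl_EFin//; last by apply/measurable_EFinP.
have h : (\int[Q]_w (expR ((a ^+ 2)^-1 * \sum_(i < m) Y i (w i) ^+ 2))%:E <=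
   (\prod_(i < m) (2 : R))%:E)%E.
  under eq_integral do rewrite mulr_sumr expR_sum.
  apply: (le_integral_prod (f := fun i w => expR ((a ^+ 2)^-1 * Y i w ^+ 2)) PQ).
  - move=> i; apply: measurableT_comp => //.
    by apply: measurable_funM => //; exact: measurable_funX.
  - by move=> i w; exact: expR_ge0.
  - by move=> i; under eq_integral do rewrite mulrC; exact: hY.
apply: (le_trans (lee_wpmul2l _ h)); first by rewrite lee_fin.
rewrite -EFinM lee_fin prodr_const card_ord /c.
have -> : 2 * k%:R * a ^+ 2 = k%:R * 2 * a ^+ 2 by ring.
rewrite mulrAC [leRHS]exprMn [(_ * 2) ^+ k]exprMn; apply: ler_wpM2r.
  by rewrite exprn_ge0// ltW.
apply: ler_pM => //.
- by rewrite -natrX ler_nat fact_le_exp.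
- by rewrite ler_weXn2l// ler1n.
Qed.

End moments_of_sums.

(** * Calculus of subgaussian and subexponential bounds *)

Section psi2.
Context (R : realType) d (Omega : measurableType d) (P : probability Omega R).
Implicit Types (X Y W : Omega -> R) (a b : R).

(** Membership of [a] in the set whose infimum is the psi_2 norm. The inequalities below are proved
    for such levels, without passing to the infimum. *)
Definition psi2_le X a := 0 < a /\
  (\int[P]_w (expR (X w ^+ 2 / a ^+ 2))%:E <= 2%:E)%E.

Lemma measurable_expR_sq X a : measurable_fun setT X ->
  measurable_fun setT (fun w => expR (X w ^+ 2 / a ^+ 2)).
Proof.
move=> mX; apply: measurableT_comp => //.
by apply: measurable_funM => //; exact: measurable_funX.
Qed.

Lemma psi2_norm_setE X a :
  ('E_P[(fun w => expR (`|X w| ^+ 2 / a ^+ 2))%R] - 1 <= 1)%E <->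
  (\int[P]_w (expR (X w ^+ 2 / a ^+ 2))%:E <= 2%:E)%E.
Proof.
rewrite expectation.unlock leeBlDr; last by [].
rewrite (_ : 1 + 1 = 2%:E :> \bar R)%E; last by rewrite -EFinD; congr EFin; lra.
by under eq_integral do rewrite real_normK ?num_real//.
Qed.

Lemma psi2_le_norm X a : psi2_le X a -> (psi2_norm P X <= a%:E)%E.
Proof.
by move=> [a0 Xa]; apply: ereal_inf_lbound; exists a => //; split=> //; exact/psi2_norm_setE.
Qed.

Lemma psi2_norm_lt X a : measurable_fun setT X ->
  (psi2_norm P X < a%:E)%E -> psi2_le X a.
Proof.
move=> mX /ereal_inf_lt [_ [b [b0 /psi2_norm_setE Xb] <-]]; rewrite lte_fin => ba.
have a0 := lt_trans b0 ba; split; [exact: a0|apply: le_trans Xb].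
apply: ge0_le_integral => //.
- by apply/measurable_EFinP; exact: measurable_expR_sq.
- by apply/measurable_EFinP; exact: measurable_expR_sq.
- move=> w _; rewrite lee_fin ler_expR ler_wpM2l ?sqr_ge0//.
  by rewrite lef_pV2 ?posrE ?exprn_gt0// ler_pXn2r ?nnegrE ?ltW.
Qed.

Lemma psi2_norm_ge0 X : (0 <= psi2_norm P X)%E.
Proof. by apply/ereal_infP => _ [a [a0 _] <-]; rewrite lee_fin ltW. Qed.

Lemma psi2_leN X a : psi2_le X a -> psi2_le (fun w => - X w) a.
Proof. by move=> [a0 Xa]; split; [exact: a0|]; under eq_integral do rewrite sqrrN. Qed.

Lemma integral_expR_conv_le (f g : Omega -> R) (s t : R) :
  measurable_fun setT f -> measurable_fun setT g ->
  0 <= s -> 0 <= t -> s + t = 1 ->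
  (\int[P]_w (expR (f w))%:E <= 2%:E)%E ->
  (\int[P]_w (expR (g w))%:E <= 2%:E)%E ->
  (\int[P]_w (expR (s * f w + t * g w))%:E <= 2%:E)%E.
Proof.
move=> mf mg s0 t0 st hf hg.
have me (h : Omega -> R) : measurable_fun setT h ->
    measurable_fun setT (fun w : Omega => (expR (h w))%:E).
  by move=> mh; apply/measurable_EFinP; exact: measurableT_comp.
have s01 : (0 <= s <= 1)%R by rewrite s0/=; lra.
apply: (@le_trans _ _ (\int[P]_w (s%:E * (expR (f w))%:E + t%:E * (expR (g w))%:E))%E).
  apply: ge0_le_integral => //.
  - by apply: me; apply: measurable_funD; apply: measurable_funM.
  - by apply: emeasurable_funD; apply: emeasurable_funM => //; exact: me.
  - move=> w _; rewrite -!EFinM -EFinD lee_fin.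
    have := convex_expR (Itv01 s0 (proj2 (andP s01))) (f w) (g w).
    by rewrite !convRE /= (_ : unstable.onem s = t)// /unstable.onem; lra.
rewrite ge0_integralD//; last 4 first.
- by move=> w _; rewrite mule_ge0// lee_fin ?expR_ge0.
- by apply: emeasurable_funM => //; exact: me.
- by move=> w _; rewrite mule_ge0// lee_fin ?expR_ge0.
- by apply: emeasurable_funM => //; exact: me.
rewrite !ge0_integralZl_EFin//; try exact: me.
apply: (le_trans (leeD (lee_wpmul2l _ hf) (lee_wpmul2l _ hg))); rewrite ?lee_fin//.
by rewrite -mulrDl st mul1r.
Qed.

(** Triangle inequality, from convexity of the exponential with weights [a / (a + b)] and
    [b / (a + b)]. The exponent of the sum lies below the convex combination because the difference
    is a square. *)
Lemma psi2_leD X Y a b : measurable_fun setT X -> measurable_fun setT Y ->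
  psi2_le X a -> psi2_le Y b -> psi2_le (fun w => X w + Y w) (a + b).
Proof.
move=> mX mY [a0 Xa] [b0 Yb]; have ab0 : 0 < a + b by rewrite addr_gt0.
split; first exact: ab0.
have mq (Z : Omega -> R) (c : R) : measurable_fun setT Z ->
    measurable_fun setT (fun w : Omega => Z w ^+ 2 / c ^+ 2).
  by move=> mZ; apply: measurable_funM => //; exact: measurable_funX.
apply: le_trans (integral_expR_conv_le (mq _ a mX) (mq _ b mY)
  (s := a / (a + b)) (t := b / (a + b)) _ _ _ Xa Yb); last 3 first.
- by rewrite divr_ge0// ltW.
- by rewrite divr_ge0// ltW.
- by rewrite -mulrDl divff// gt_eqF.
apply: ge0_le_integral => //.
- by apply/measurable_EFinP; apply: measurableT_comp => //; apply: mq; exact: measurable_funD.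
- apply/measurable_EFinP; apply: measurableT_comp => //.
  by apply: measurable_funD; apply: measurable_funM => //; exact: mq.
move=> w _; rewrite lee_fin ler_expR.
rewrite -subr_ge0.
have -> : a / (a + b) * (X w ^+ 2 / a ^+ 2) + b / (a + b) * (Y w ^+ 2 / b ^+ 2) -
  (X w + Y w) ^+ 2 / (a + b) ^+ 2 = (b * X w - a * Y w) ^+ 2 / (a * b * (a + b) ^+ 2).
  by field; rewrite !gt_eqF.
by rewrite divr_ge0 ?sqr_ge0// !mulr_ge0 ?sqr_ge0 ?(ltW a0) ?(ltW b0) ?(ltW ab0).
Qed.

(** By the arithmetic-geometric mean inequality a product of two subgaussian variables is
    subexponential, with scale the product of the scales. *)
Lemma psi2_leM X Y a b : measurable_fun setT X -> measurable_fun setT Y ->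
  psi2_le X a -> psi2_le Y b ->
  (\int[P]_w (expR (`|X w * Y w| / (a * b)))%:E <= 2%:E)%E.
Proof.
move=> mX mY [a0 Xa] [b0 Yb].
have mq (Z : Omega -> R) (c : R) : measurable_fun setT Z ->
    measurable_fun setT (fun w : Omega => Z w ^+ 2 / c ^+ 2).
  by move=> mZ; apply: measurable_funM => //; exact: measurable_funX.
apply: le_trans (integral_expR_conv_le (mq _ a mX) (mq _ b mY)
  (s := 2^-1) (t := 2^-1) _ _ _ Xa Yb) => //; last by lra.
apply: ge0_le_integral => //.
- apply/measurable_EFinP; apply: measurableT_comp => //; apply: measurable_funM => //.
  by apply: measurableT_comp => //; exact: measurable_funM.
- apply/measurable_EFinP; apply: measurableT_comp => //.
  by apply: measurable_funD; apply: measurable_funM => //; exact: mq.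
move=> w _; rewrite lee_fin ler_expR normrM.
rewrite -[X w ^+ 2]real_normK ?num_real// -[Y w ^+ 2]real_normK ?num_real//.
rewrite -subr_ge0.
have -> : 2^-1 * (`|X w| ^+ 2 / a ^+ 2) + 2^-1 * (`|Y w| ^+ 2 / b ^+ 2) -
  `|X w| * `|Y w| / (a * b) = 2^-1 * (`|X w| / a - `|Y w| / b) ^+ 2.
  by field; rewrite !gt_eqF.
by rewrite mulr_ge0 ?sqr_ge0.
Qed.

Section psi1.
Variables (W : Omega -> R) (kappa : R).
Hypotheses (mW : measurable_fun setT W) (k0 : 0 < kappa)
  (hW : (\int[P]_w (expR (`|W w| / kappa))%:E <= 2%:E)%E).

(** Integrate [1 + x <= e^x] at [x = |W| / kappa]. *)
Lemma psi1_abs_le : (\int[P]_w `|W w|%:E <= kappa%:E)%E.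
Proof.
have mA : measurable_fun setT (fun w => `|W w|%:E).
  by apply/measurable_EFinP; apply: measurableT_comp.
have h : (1 + kappa^-1%:E * \int[P]_w `|W w|%:E <= 2%:E)%E.
  apply: le_trans hW.
  rewrite -ge0_integralZl_EFin ?invr_ge0 ?(ltW k0)//.
  rewrite (_ : 1 = \int[P]_w (1 : \bar R))%E; last first.
    by rewrite integral_cst// mul1e; exact: esym (@probability_setT _ _ _ P).
  rewrite -ge0_integralD//; last 2 first.
  - by move=> w _; rewrite mule_ge0// lee_fin ?invr_ge0 ?(ltW k0).
  - by apply: emeasurable_funM.
  apply: ge0_le_integral => //.
  - by move=> w _; rewrite adde_ge0// mule_ge0// lee_fin ?invr_ge0 ?(ltW k0).
  - by apply: emeasurable_funD => //; apply: emeasurable_funM.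
  - apply/measurable_EFinP; apply: measurableT_comp => //; apply: measurable_funM => //.
    by apply: measurableT_comp.
  by move=> w _; rewrite -EFinM -EFinD lee_fin mulrC expR_ge1Dx.
have I0 : (0 <= \int[P]_w `|W w|%:E)%E by apply: integral_ge0 => w _; rewrite lee_fin.
move: h I0; case: (\int[P]_w `|W w|%:E)%E => [r| |//].
  rewrite -EFinM -EFinD !lee_fin => h r0.
  by rewrite -(@ler_pM2l _ kappa^-1) ?invr_gt0// mulVf ?gt_eqF//; lra.
by rewrite gt0_muley ?lte_fin ?invr_gt0.
Qed.

Lemma psi1_integrable : P.-integrable setT (EFin \o W).
Proof.
apply/integrableP; split; first exact/measurable_EFinP.
exact: le_lt_trans psi1_abs_le (ltry _).
Qed.

Lemma psi1_mean_le : `|fine (\int[P]_w (W w)%:E)%E| <= kappa.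
Proof.
have fi : (\int[P]_w (W w)%:E)%E \is a fin_num.
  exact: (integrable_fin_num _ psi1_integrable).
rewrite -lee_fin -[X in (X <= _)%E]/(`|(fine _)%:E|)%E fineK//.
apply: le_trans psi1_abs_le.
by apply: le_abse_integral => //; exact/measurable_EFinP.
Qed.

Let Z w := W w - fine (\int[P]_w (W w)%:E)%E.

Lemma psi1_center_integrable : P.-integrable setT (EFin \o Z).
Proof.
rewrite (_ : EFin \o Z = (EFin \o W) \- (cst (fine (\int[P]_w (W w)%:E))%:E))%E.
  by apply: integrableB => //; [exact: psi1_integrable|exact: finite_measure_integrable_cst].
by apply/funext => w; rewrite /= /Z EFinB.
Qed.

Lemma psi1_center_mean : (\int[P]_w (Z w)%:E = 0)%E.
Proof.
have fi : (\int[P]_w (W w)%:E)%E \is a fin_num.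
  exact: (integrable_fin_num _ psi1_integrable).
under eq_integral do rewrite /Z EFinB.
rewrite integralB//; last 2 first.
- exact: psi1_integrable.
- exact: finite_measure_integrable_cst.
rewrite integral_cst// fineK//.
rewrite [X in (_ * X)%E](@probability_setT _ _ _ P).
by rewrite mule1 subee.
Qed.

(** Centering shifts [|W| / kappa] by at most 1, which multiplies the exponential by [e <= 4]. With
    the bound 2 on the exponential moment this gives the factor 8. *)
Lemma psi1_center_moment n :
  (\int[P]_w (`|Z w| ^+ n)%:E <= (n`!%:R * 8 * kappa ^+ n)%:E)%E.
Proof.
pose c := n`!%:R * kappa ^+ n * 4.
have c0 : 0 <= c by rewrite !mulr_ge0// exprn_ge0// ltW.
have mE : measurable_fun setT (fun w => expR (`|W w| / kappa)).
  apply: measurableT_comp => //; apply: measurable_funM => //.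
  by apply: measurableT_comp.
apply: (@le_trans _ _ (\int[P]_w (c%:E * (expR (`|W w| / kappa))%:E))%E).
  apply: ge0_le_integral => //.
  - by apply/measurable_EFinP; apply: measurable_normX; exact: measurable_funB.
  - by apply: emeasurable_funM => //; apply/measurable_EFinP.
  move=> w _; rewrite -EFinM lee_fin.
  have Zk : `|Z w| / kappa <= 1 + `|W w| / kappa.
    rewrite ler_pdivrMr// mulrDl mul1r mulfVK ?gt_eqF// addrC.
    by apply: (le_trans (ler_normB _ _)); rewrite lerD2l psi1_mean_le.
  have Zk0 : 0 <= `|Z w| / kappa by rewrite divr_ge0// ltW.
  have := expR_ge_fact n Zk0.
  rewrite exprMn exprVn ler_pdivrMr ?exprn_gt0// => h.
  apply: (le_trans h); rewrite /c mulrAC -!mulrA ler_wpM2l ?ler0n//.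
  rewrite ler_wpM2l ?exprn_ge0 ?(ltW k0)//.
  apply: (@le_trans _ _ (expR (1 + `|W w| / kappa))); first by rewrite ler_expR.
  by rewrite expRD ler_wpM2r ?expR_ge0// expR1_le4.
rewrite ge0_integralZl_EFin//; last by apply/measurable_EFinP.
apply: (le_trans (lee_wpmul2l _ hW)); rewrite ?lee_fin//.
by rewrite /c le_eqVlt; apply/orP; left; apply/eqP; ring.
Qed.

End psi1.

End psi2.

(** * Moments of the increments and of the starting points *)

Section empirical_process.
Context (R : realType) (m : nat) (d : 'I_m -> measure_display)
  (Omega : forall i, measurableType (d i))
  (P : forall i, probability (Omega i) R)
  (Q : probability (dprod Omega) R)
  (S : 'I_m -> Type) (X : forall i, S i -> {RV (P i) >-> R}).
Hypotheses (m0 : (0 < m)%N) (PQ : is_product_probability P Q).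
Implicit Types (u v t : forall i, S i) (a b : R) (q : nat).

Definition psi2_radius_le t b := forall i, psi2_le (P i) (X (t i)) b.
Definition psi2_dist_le u v a :=
  forall i, psi2_le (P i) (fun w => X (u i) w - X (v i) w) a.

Definition emp_sqdist u v (w : dprod Omega) : R :=
  m%:R^-1 * \sum_(i < m) (X (u i) (w i) - X (v i) (w i)) ^+ 2.

Definition avg_square t (w : dprod Omega) : R :=
  m%:R^-1 * \sum_(i < m) (X (t i) (w i)) ^+ 2.

Definition avg_mean_square t : R :=
  m%:R^-1 * \sum_(i < m) fine (\int[P i]_w (X (t i) w ^+ 2)%:E).

Let mpos : 0 < m%:R :> R. Proof. by rewrite ltr0n. Qed.

Lemma avg_centered_squareE t w :
  avg_centered_square X t w = avg_square t w - avg_mean_square t.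
Proof.
rewrite /avg_centered_square /avg_square /avg_mean_square -mulrBr -sumrB.
by congr (_ * _); apply: eq_bigr => i _; rewrite /centered_square expectation.unlock.
Qed.

Let mX i (x : S i) : measurable_fun setT (X x : Omega i -> R).
Proof. exact: measurable_funP. Qed.

Lemma measurable_centered_square i (x : S i) :
  measurable_fun setT (@centered_square _ _ _ _ P S X i x).
Proof.
by apply: measurable_funB => //; apply: measurable_funX; exact: mX.
Qed.

Lemma measurable_avg_centered_square t :
  measurable_fun setT (avg_centered_square X t).
Proof.
apply: measurable_funM => //.
apply: (measurable_sum_coord (Z := fun i => @centered_square _ _ _ _ P S X i (t i))).
by move=> i; exact: measurable_centered_square.
Qed.

Lemma measurable_emp_sqdist u v : measurable_fun setT (emp_sqdist u v).
Proof.
apply: measurable_funM => //.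
apply: (measurable_sum_coord (Z := fun i w => (X (u i) w - X (v i) w) ^+ 2)).
by move=> i; apply: measurable_funX; apply: measurable_funB; exact: mX.
Qed.

Let square_psi1 i (x : S i) b : psi2_le (P i) (X x) b ->
  (\int[P i]_w (expR (`|X x w ^+ 2| / (b * b)))%:E <= 2%:E)%E.
Proof. by move=> xb; apply: (psi2_leM _ _ xb xb); exact: mX. Qed.

Lemma integrable_square i (x : S i) b : psi2_le (P i) (X x) b ->
  (P i).-integrable setT (EFin \o (fun w => X x w ^+ 2)).
Proof.
move=> h; case: (h) => b0 _.
apply: (psi1_integrable (kappa := b * b)); rewrite ?mulr_gt0//.
  by apply: measurable_funX; exact: mX.
exact: square_psi1.
Qed.

Lemma avg_mean_square_bounds t b : psi2_radius_le t b ->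
  0 <= avg_mean_square t <= b ^+ 2.
Proof.
move=> h.
have hi i : 0 <= fine (\int[P i]_w (X (t i) w ^+ 2)%:E) <= b ^+ 2.
  apply/andP; split.
    by apply: fine_ge0; apply: integral_ge0 => w _; rewrite lee_fin sqr_ge0.
  case: (h i) => b0 _; rewrite expr2.
  apply: le_trans (ler_norm _) _; apply: psi1_mean_le.
  - by apply: measurable_funX; exact: mX.
  - by rewrite mulr_gt0.
  - exact: square_psi1.
rewrite /avg_mean_square mulr_ge0 ?invr_ge0 ?ler0n//=; last first.
  by apply: sumr_ge0 => i _; case/andP: (hi i).
rewrite ler_pdivrMl//; apply: (@le_trans _ _ (\sum_(i < m) b ^+ 2)).
  by apply: ler_sum => i _; case/andP: (hi i).
by rewrite sumr_const card_ord mulr_natl.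
Qed.

Section increments.
Variables (u v : forall i, S i) (a b : R).
Hypotheses (uv : psi2_dist_le u v a) (ub : psi2_radius_le u b)
  (vb : psi2_radius_le v b).

Let W i (w : Omega i) := X (u i) w ^+ 2 - X (v i) w ^+ 2.
Let kappa := a * (b + b).

Let mW i : measurable_fun setT (@W i).
Proof. by apply: measurable_funB; apply: measurable_funX; exact: mX. Qed.

Let kappa0 : 0 < kappa.
Proof.
case: (uv (Ordinal m0)) => a0 _; case: (ub (Ordinal m0)) => b0 _.
by rewrite mulr_gt0// addr_gt0.
Qed.

(** A difference of squares factors as difference times sum, of scales [a] and [b + b]. *)
Let hW i : (\int[P i]_w (expR (`|W w| / kappa))%:E <= 2%:E)%E.
Proof.
have := psi2_leM (measurable_funB (mX (u i)) (mX (v i)))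
  (measurable_funD (mX (u i)) (mX (v i))) (uv i)
  (psi2_leD (mX (u i)) (mX (v i)) (ub i) (vb i)).
by under eq_integral do rewrite -subr_sqr.
Qed.

Let WE i : fine (\int[P i]_w (W w)%:E)%E =
  fine (\int[P i]_w (X (u i) w ^+ 2)%:E) - fine (\int[P i]_w (X (v i) w ^+ 2)%:E).
Proof.
have iu := integrable_square (ub i); have iv := integrable_square (vb i).
under eq_integral do rewrite EFinB.
by rewrite integralB// fineB//; apply: integrable_fin_num.
Qed.

Lemma avg_mean_square_dist :
  `|avg_mean_square u - avg_mean_square v| <= 2 * a * b.
Proof.
rewrite /avg_mean_square -mulrBr -sumrB normrM ger0_norm ?invr_ge0 ?ler0n//.
rewrite ler_pdivrMl//; apply: (le_trans (ler_norm_sum _ _ _)).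
apply: (@le_trans _ _ (\sum_(i < m) kappa)).
  by apply: ler_sum => i _; rewrite -WE; exact: (psi1_mean_le (mW (i:=i)) kappa0 (hW i)).
by rewrite sumr_const card_ord (_ : 2 * a * b = kappa) ?mulr_natl// /kappa; ring.
Qed.

Lemma increment_moment q : (0 < q)%N -> (q <= m)%N ->
  (\int[Q]_w (`|avg_centered_square X u w - avg_centered_square X v w| ^+ q)%:E <=
   ((96 * Num.sqrt (q%:R / m%:R) * (a * b)) ^+ q)%:E)%E.
Proof.
move=> q0 qm.
pose Z i w := @W i w - fine (\int[P i]_w (W w)%:E)%E.
have AZ w : avg_centered_square X u w - avg_centered_square X v w =
    m%:R^-1 * \sum_(i < m) Z i (w i).
  rewrite /avg_centered_square -mulrBr -sumrB; congr (_ * _).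
  by apply: eq_bigr => i _; rewrite /Z WE /W /centered_square expectation.unlock; ring.
have mZ i : measurable_fun setT (Z i) by apply: measurable_funB.
(* The [m] centered moments of order [k] sum to at most [m * 8 * k! * kappa^k]; written as
   [k! / 2 * vv * kappa^(k-2)] this forces the 16. *)
pose vv := m%:R * 16 * kappa ^+ 2.
have vv0 : 0 < vv.
  by apply: mulr_gt0; [exact: mulr_gt0|exact: exprn_gt0 kappa0].
have i1 i : (P i).-integrable setT (EFin \o Z i).
  exact: (psi1_center_integrable (mW (i:=i)) kappa0 (hW i)).
have i2 i : (\int[P i]_w (Z i w)%:E = 0)%E.
  exact: (psi1_center_mean (mW (i:=i)) kappa0 (hW i)).
have h := bernstein_moment PQ mZ i1 i2 vv0 kappa0 q0.
under eq_integral do rewrite AZ normrM exprMn EFinM.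
rewrite ge0_integralZl_EFin//; last first.
  by apply/measurable_EFinP; apply: measurable_normX; exact: measurable_sum_coord.
apply: (le_trans (lee_wpmul2l _ (h _))).
- by rewrite lee_fin exprn_ge0.
- move=> k; apply: (@le_trans _ _ (\sum_(i < m) (k.+2`!%:R * 8 * kappa ^+ k.+2)%:E)%E).
    apply: lee_sum => i _.
    exact: (psi1_center_moment (mW (i:=i)) kappa0 (hW i)).
  rewrite sumEFin lee_fin sumr_const card_ord -[leLHS]mulr_natl /vv -[k.+2]addn2 exprD.
  rewrite le_eqVlt; apply/orP; left; apply/eqP.
  by move: (_`!%:R : R) (kappa ^+ k) (kappa ^+ 2) => x y z; field.
rewrite -EFinM lee_fin -exprMn; apply: lerXn2r.
- rewrite nnegrE mulr_ge0// mulr_ge0// addr_ge0 ?sqrtr_ge0//.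
  by rewrite mulr_ge0 ?(ltW kappa0)// mulr_ge0.
- rewrite nnegrE mulr_ge0// ?mulr_ge0 ?sqrtr_ge0//.
    by case: (uv (Ordinal m0)) => /ltW.
  by case: (ub (Ordinal m0)) => /ltW.
set r := Num.sqrt (q%:R / m%:R).
have r2 : r ^+ 2 = q%:R / m%:R by rewrite sqr_sqrtr ?divr_ge0.
have r0 : 0 <= r by rewrite sqrtr_ge0.
have -> : Num.sqrt (q%:R * vv) = 4 * m%:R * r * kappa.
  have -> : q%:R * vv = (4 * m%:R * r * kappa) ^+ 2.
    rewrite (_ : (4 * m%:R * r * kappa) ^+ 2 =
      16 * m%:R ^+ 2 * r ^+ 2 * kappa ^+ 2); last by ring.
    by rewrite r2 /vv; field; rewrite gt_eqF.
  by rewrite sqrtr_sqr ger0_norm// mulr_ge0 ?(ltW kappa0)// mulr_ge0.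
(* Here [q <= m] is used: it gives [r ^+ 2 <= r], so the linear Bernstein term is absorbed by the
   square root term and [16 * (2 * r + r ^+ 2)] is at most [48 * r]. *)
have r1 : r <= 1.
  rewrite -(@ler_pXn2r _ 2) ?nnegrE// r2 expr1n ler_pdivrMr// mul1r ler_nat//.
have -> : q%:R = m%:R * r ^+ 2 by rewrite r2; field; rewrite gt_eqF.
rewrite ger0_norm ?invr_ge0 ?ler0n//.
have -> : m%:R^-1 * (8 * (4 * m%:R * r * kappa + 2 * (m%:R * r ^+ 2) * kappa)) =
   16 * (2 * r + r ^+ 2) * kappa by field; rewrite gt_eqF.
have -> : 96 * r * (a * b) = 48 * r * kappa by rewrite /kappa; ring.
by rewrite ler_pM2r//; nra.
Qed.

Lemma emp_sqdist_moment q : (m <= q)%N ->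
  (\int[Q]_w (emp_sqdist u v w ^+ q)%:E <=
   ((2 * (q%:R / m%:R) * a ^+ 2) ^+ q)%:E)%E.
Proof.
move=> mq.
have a0 : 0 < a by case: (uv (Ordinal m0)).
under eq_integral do rewrite /emp_sqdist exprMn EFinM.
rewrite ge0_integralZl_EFin//; last 2 first.
- move=> w _; rewrite lee_fin exprn_ge0// sumr_ge0// => i _; exact: sqr_ge0.
- apply/measurable_EFinP; apply: measurable_funX.
  apply: (measurable_sum_coord (Z := fun i w => (X (u i) w - X (v i) w) ^+ 2)).
  by move=> i; apply: measurable_funX; apply: measurable_funB; exact: mX.
have := @square_sum_moment _ _ _ _ _ _ PQ
  (fun i w => X (u i) w - X (v i) w) a q a0 mq.
move=> /(_ (fun i => measurable_funB (mX (u i)) (mX (v i))) (fun i => (uv i).2)) h.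
apply: (le_trans (lee_wpmul2l _ h)).
  by rewrite lee_fin exprn_ge0.
rewrite -EFinM -exprMn lee_fin le_eqVlt; apply/orP; left; apply/eqP.
by congr (_ ^+ q); field; rewrite gt_eqF.
Qed.

End increments.

(** Bernstein's inequality with total variance [m * sigma ^+ 2]. The radius [b] only provides
    integrability and does not enter the bound. *)
Lemma base_moment t b (sigma K : R) q :
  psi2_radius_le t b -> 0 < sigma -> 0 < K -> (0 < q)%N ->
  (forall k, avg_moment X k.+2 t <=
    (k.+2`!%:R / 2 * sigma ^+ 2 * K ^+ k)%:E)%E ->
  (\int[Q]_w (`|avg_centered_square X t w| ^+ q)%:E <=
   ((8 * (Num.sqrt q%:R * (sigma / Num.sqrt m%:R) + 2 * q%:R * (K / m%:R))) ^+ q)%:E)%E.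
Proof.
move=> tb s0 K0 q0 mom.
pose Z i w := @centered_square _ _ _ _ P S X i (t i) w.
have mZ i : measurable_fun setT (Z i) by exact: measurable_centered_square.
pose v := m%:R * sigma ^+ 2.
have v0 : 0 < v by rewrite mulr_gt0 ?exprn_gt0.
have b0 (i : 'I_m) : 0 < b * b by case: (tb i) => b0 _; rewrite mulr_gt0.
have mW i : measurable_fun setT (fun w => X (t i) w ^+ 2).
  by apply: measurable_funX; exact: mX.
have ZE i : Z i = fun w => X (t i) w ^+ 2 - fine (\int[P i]_w (X (t i) w ^+ 2)%:E)%E.
  by apply/funext => w; rewrite /Z /centered_square expectation.unlock.
have i1 i : (P i).-integrable setT (EFin \o Z i).
  by rewrite ZE; exact: (psi1_center_integrable (mW i) (b0 i) (square_psi1 (tb i))).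
have i2 i : (\int[P i]_w (Z i w)%:E = 0)%E.
  by rewrite ZE; exact: (psi1_center_mean (mW i) (b0 i) (square_psi1 (tb i))).
have h : (\int[Q]_w (`|\sum_(i < m) Z i (w i)| ^+ q)%:E <=
    ((8 * (Num.sqrt (q%:R * v) + 2 * q%:R * K)) ^+ q)%:E)%E.
  apply: (bernstein_moment PQ mZ i1 i2 v0 K0 q0) => k.
  have mR0 : (0 <= m%:R%:E :> \bar R)%E by rewrite lee_fin.
  have := lee_wpmul2l mR0 (mom k); rewrite /avg_moment expectation.unlock.
  rewrite muleA -EFinM divff ?gt_eqF// mul1e => mk; apply: (le_trans mk).
  by rewrite -EFinM lee_fin le_eqVlt; apply/orP; left; apply/eqP; rewrite /v; ring.
under eq_integral do rewrite /avg_centered_square normrM exprMn EFinM.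
rewrite ge0_integralZl_EFin//; last first.
  by apply/measurable_EFinP; apply: measurable_normX; exact: (measurable_sum_coord (Z := Z)).
apply: (le_trans (lee_wpmul2l _ h)); first by rewrite lee_fin exprn_ge0.
rewrite -EFinM lee_fin -exprMn le_eqVlt; apply/orP; left; apply/eqP.
congr (_ ^+ q); rewrite ger0_norm ?invr_ge0 ?ler0n//.
have sm0 : 0 < Num.sqrt m%:R :> R by rewrite sqrtr_gt0.
have sm2 : m%:R = Num.sqrt m%:R ^+ 2 :> R by rewrite sqr_sqrtr.
have -> : Num.sqrt (q%:R * v) = Num.sqrt q%:R * (Num.sqrt m%:R * sigma).
  by rewrite sqrtrM// /v sqrtrM// sqrtr_sqr gtr0_norm.
by rewrite sm2 sqrtr_sqr (gtr0_norm sm0); field; rewrite gt_eqF.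
Qed.

End empirical_process.

(** * Deterministic comparison of [A] with the empirical distance *)

Section chaining.
Context (R : realType) (m : nat) (d : 'I_m -> measure_display)
  (Omega : forall i, measurableType (d i))
  (P : forall i, probability (Omega i) R)
  (S : 'I_m -> Type) (X : forall i, S i -> {RV (P i) >-> R}).
Hypothesis m0 : (0 < m)%N.
Implicit Types (u v t : forall i, S i) (w : dprod Omega) (n k : nat).

Let mpos : 0 < m%:R :> R. Proof. by rewrite ltr0n. Qed.

Lemma emp_sqdist_ge0 u v w : 0 <= emp_sqdist X u v w.
Proof.
by rewrite mulr_ge0 ?invr_ge0 ?ler0n// sumr_ge0// => i _; exact: sqr_ge0.
Qed.

(* [(x + y)^2 <= (a + b) (x^2 / a + y^2 / b)] *)
Lemma emp_sqdist_triangle u v t w (a b : R) : 0 < a -> 0 < b ->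
  emp_sqdist X u v w <= a ^+ 2 -> emp_sqdist X v t w <= b ^+ 2 ->
  emp_sqdist X u t w <= (a + b) ^+ 2.
Proof.
move=> a0 b0 uv vt.
have ab0 : 0 < a + b by rewrite addr_gt0.
apply: (@le_trans _ _ ((a + b) * (emp_sqdist X u v w / a + emp_sqdist X v t w / b))).
  rewrite /emp_sqdist.
  rewrite -!mulrA -mulrDr mulrCA ler_wpM2l ?invr_ge0 ?ler0n//.
  rewrite !mulr_suml -big_split/= mulr_sumr; apply: ler_sum => i _.
  set x := X (u i) (w i); set y := X (v i) (w i); set z := X (t i) (w i).
  rewrite -subr_ge0.
  have -> : (a + b) * ((x - y) ^+ 2 / a + (y - z) ^+ 2 / b) - (x - z) ^+ 2 =
    (b * (x - y) - a * (y - z)) ^+ 2 / (a * b) by field; rewrite !gt_eqF.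
  by rewrite divr_ge0 ?sqr_ge0// mulr_ge0 ?(ltW a0) ?(ltW b0).
rewrite [leRHS]expr2 ler_wpM2l ?(ltW ab0)// lerD// ler_pdivrMr// -expr2//.
Qed.

(** Coordinatewise, [x^2 - y^2 = (x - y)^2 + 2 (x - y) y], and the cross term is split by Young's
    inequality with weight [theta]. The two squares in the proof treat its two signs. *)
Lemma avg_square_dist t v w (theta : R) : 0 < theta ->
  `|avg_square X t w - avg_square X v w| <=
   (1 + theta^-1) * emp_sqdist X t v w + theta * avg_square X v w.
Proof.
move=> th0; rewrite /avg_square /emp_sqdist -mulrBr -sumrB normrM.
rewrite ger0_norm ?invr_ge0 ?ler0n// mulrCA [theta * _]mulrCA -mulrDr.
rewrite ler_wpM2l ?invr_ge0 ?ler0n//.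
apply: (le_trans (ler_norm_sum _ _ _)).
rewrite !mulr_sumr -big_split/=; apply: ler_sum => i _.
set x := X (t i) (w i); set y := X (v i) (w i).
have h1 : 0 <= ((x - y) / theta - y) ^+ 2 * theta by rewrite mulr_ge0 ?sqr_ge0 ?(ltW th0).
have h2 : 0 <= ((x - y) / theta + y) ^+ 2 * theta by rewrite mulr_ge0 ?sqr_ge0 ?(ltW th0).
have e1 : ((x - y) / theta - y) ^+ 2 * theta =
  theta^-1 * (x - y) ^+ 2 - 2 * (x - y) * y + theta * y ^+ 2 by field; rewrite gt_eqF.
have e2 : ((x - y) / theta + y) ^+ 2 * theta =
  theta^-1 * (x - y) ^+ 2 + 2 * (x - y) * y + theta * y ^+ 2 by field; rewrite gt_eqF.
rewrite e1 in h1; rewrite e2 in h2; rewrite mulrDl mul1r.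
move: (theta^-1 * _) (theta * _) h1 h2 => p q h1 h2.
by rewrite ler_norml; apply/andP; split; nra.
Qed.

(** The empirical square norm at [v] is random, but it is at most [|A_v| + b ^+ 2]. This is why
    [|A_v|] comes back on the right with factor 2. *)
Lemma avg_centered_square_dist t v w (a b : R) : 0 < a -> 0 < b ->
  psi2_radius_le X v b -> emp_sqdist X t v w <= a ^+ 2 ->
  `|avg_centered_square X t w| <= 2 * `|avg_centered_square X v w| +
    2 * a ^+ 2 + 2 * a * b + `|avg_mean_square X t - avg_mean_square X v|.
Proof.
move=> a0 b0 vb tv.
have ab0 : 0 < a + b by rewrite addr_gt0.
(* With this weight [a ^+ 2 / th = a * (a + b)] and [th * b ^+ 2 <= a * b]. *)
pose th := a / (a + b).
have th0 : 0 < th by rewrite divr_gt0.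
have th1 : th <= 1 by rewrite ler_pdivrMr// mul1r lerDl ltW.
have h := avg_square_dist t v w th0.
have hv : avg_square X v w <= `|avg_centered_square X v w| + b ^+ 2.
  rewrite -[leLHS](subrK (avg_mean_square X v)) -avg_centered_squareE lerD//.
    exact: ler_norm.
  by case/andP: (avg_mean_square_bounds m0 vb).
have hU : (1 + th^-1) * emp_sqdist X t v w <= 2 * a ^+ 2 + a * b.
  apply: (@le_trans _ _ ((1 + th^-1) * a ^+ 2)).
    by rewrite ler_wpM2l// addr_ge0// invr_ge0 ltW.
  rewrite le_eqVlt; apply/orP; left; apply/eqP.
  by rewrite /th; field; rewrite !gt_eqF.
have hth : th * avg_square X v w <= `|avg_centered_square X v w| + a * b.
  apply: (@le_trans _ _ (th * (`|avg_centered_square X v w| + b ^+ 2))).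
    by rewrite ler_wpM2l// ltW.
  rewrite mulrDr lerD//; first by rewrite ler_piMl.
  rewrite /th mulrAC ler_pdivrMr// expr2 mulrA ler_wpM2l ?mulr_ge0 ?(ltW a0) ?(ltW b0)//.
  by rewrite lerDr ltW.
rewrite [avg_centered_square X t w]avg_centered_squareE.
have -> : avg_square X t w - avg_mean_square X t =
  avg_centered_square X v w + (avg_square X t w - avg_square X v w)
    - (avg_mean_square X t - avg_mean_square X v).
  by rewrite [avg_centered_square X v w]avg_centered_squareE; ring.
apply: (le_trans (ler_normB _ _)); rewrite lerD2r.
apply: (le_trans (ler_normD _ _)).
by move: h hU hth; lra.
Qed.

Definition root2 n : R := 2 `^ (n%:R / 2).

Lemma root2_sqr n : root2 n ^+ 2 = 2 ^+ n.
Proof.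
by rewrite /root2 -powR_mulrn ?powR_ge0// -powRrM divfK ?pnatr_eq0// powR_mulrn.
Qed.

Lemma root2_gt0 n : 0 < root2 n. Proof. exact: powR_gt0. Qed.

Lemma root2_le n : root2 n <= root2 n.+1.
Proof.
by rewrite ler_powR ?ler1n// ler_pM2r// ler_nat.
Qed.

Definition chain_exp n := (2 ^ n.+3)%N.

Lemma chain_exp_sqrt n :
  Num.sqrt ((chain_exp n)%:R / m%:R) <= 3 * (root2 n / Num.sqrt m%:R).
Proof.
have sm0 : 0 < Num.sqrt m%:R :> R by rewrite sqrtr_gt0.
rewrite mulrA -[leRHS]ger0_norm; last first.
  by apply: ltW; rewrite divr_gt0// mulr_gt0// root2_gt0.
rewrite -sqrtr_sqr ler_wsqrtr// exprMn exprVn sqr_sqrtr ?ler0n//.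
rewrite ler_wpM2r ?invr_ge0 ?ler0n// exprMn root2_sqr /chain_exp natrX.
rewrite -[n.+3]addn3 exprD; have : 0 < 2 ^+ n :> R by rewrite exprn_gt0.
by set x := 2 ^+ n; rewrite !exprS expr0; lra.
Qed.

Definition chain_step n u v w : R :=
  if (chain_exp n <= m)%N
  then `|avg_centered_square X u w - avg_centered_square X v w|
  else emp_sqdist X u v w.

(** The bound on the L^q norm of [chain_step], [q = chain_exp n], for a link of length [a]. It is
    quadratic in [a] in the second regime because [chain_step] is then a squared distance. *)
Definition chain_scale (b : R) n (a : R) : R :=
  if (chain_exp n <= m)%N
  then 96 * Num.sqrt ((chain_exp n)%:R / m%:R) * (a * b)
  else 2 * ((chain_exp n)%:R / m%:R) * a ^+ 2.

(** * Chaining along one path at a fixed outcome, where [V] stands for the p-th root of the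
    weight *)

Section one_path.
Variables (w : dprod Omega) (t : forall i, S i) (x : nat -> forall i, S i)
  (l N : nat) (dist : nat -> R) (D : nat -> R) (b B V gam : R).
Hypotheses (lN : (l <= N)%N) (xN : x N = t) (b0 : 0 < b) (V1 : 1 <= V)
  (dist0 : forall n, 0 < dist n) (D0 : forall n, 0 < D n)
  (Ddist : forall n, D n <= dist n + dist n.+1)
  (tb : psi2_radius_le X t b) (xb : forall n, psi2_radius_le X (x n) b)
  (tx : forall n, psi2_dist_le X t (x n) (dist n))
  (gamE : \sum_(l <= n < N.+1) root2 n * dist n <= gam)
  (base : `|avg_centered_square X (x l) w| <= B * V)
  (step : forall n, (l <= n < N)%N ->
     chain_step n (x n.+1) (x n) w <= 2 * chain_scale b n (D n) * V).

Let sm0 : 0 < Num.sqrt m%:R :> R. Proof. by rewrite sqrtr_gt0. Qed.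
Let V0 : 0 < V. Proof. exact: lt_le_trans V1. Qed.
Let pos n : 0 < root2 n * dist n. Proof. by rewrite mulr_gt0 ?root2_gt0. Qed.
Let root2D n : root2 n * D n <= root2 n * dist n + root2 n.+1 * dist n.+1.
Proof.
apply: (@le_trans _ _ (root2 n * (dist n + dist n.+1))).
  exact: ler_wpM2l (ltW (root2_gt0 n)) _ _ (Ddist n).
rewrite mulrDr lerD2l.
exact: ler_wpM2r (ltW (dist0 n.+1)) _ _ (root2_le n).
Qed.

Let gam_part k k' : (l <= k)%N -> (k <= k')%N -> (k' <= N.+1)%N ->
  \sum_(k <= n < k') root2 n * dist n <= gam.
Proof.
move=> lk kk' kN; apply: le_trans gamE.
rewrite (big_cat_nat lk) /=; last exact: leq_trans kN.
rewrite (big_cat_nat kk' kN)/= addrCA lerDl.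
by rewrite addr_ge0// sumr_ge0// => n _; exact: ltW (pos n).
Qed.

Let gam0 : 0 <= gam.
Proof.
by have := gam_part (leqnn l) (leqnn l) (leqW lN); rewrite big_geq.
Qed.

(** Telescoping of [A] upwards from level [l]. In a link, 576 is the product of 2 from [step], 96
    from [chain_scale] and 3 from [chain_exp_sqrt]; it doubles to 1152 because [g n <= 2 * gam]. *)
Let coarse n : (l <= n <= N)%N ->
  (forall k, (l <= k < n)%N -> (chain_exp k <= m)%N) ->
  `|avg_centered_square X (x n) w| <=
    B * V + 1152 * (b * gam / Num.sqrt m%:R) * V.
Proof.
move=> /andP[ln nN] hk.
(* [g] increases by [root2 n * dist n + root2 n.+1 * dist n.+1], which dominates
   the link from level [n] to level [n.+1]. *)
pose g n := root2 n * dist n + 2 * \sum_(l <= k < n) root2 k * dist k.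
have c0 : 0 <= 576 * (b / Num.sqrt m%:R) * V.
  apply: mulr_ge0; last exact: ltW.
  by apply: mulr_ge0; [exact: ler0n|exact: ltW (divr_gt0 b0 sm0)].
have : `|avg_centered_square X (x n) w| <=
    B * V + 576 * (b / Num.sqrt m%:R) * V * g n.
  elim: n ln nN hk => [|n IH] ln nN hk.
    move: ln base; rewrite leqn0 => /eqP ->; rewrite /g big_nil mulr0 addr0 => h.
    by apply: (le_trans h); rewrite lerDl; exact: (mulr_ge0 c0 (ltW (pos 0))).
  move: ln; rewrite leq_eqVlt => /predU1P[ln|ln].
    rewrite -ln /g big_geq// mulr0 addr0.
    by apply: (le_trans base); rewrite lerDl; exact: (mulr_ge0 c0 (ltW (pos l))).
  rewrite ltnS in ln.
  have {}IH := IH ln (ltnW nN).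
  have := step (n := n); rewrite ln nN => /(_ isT).
  have qm : (chain_exp n <= m)%N by apply: hk; rewrite ln/= leqnn.
  rewrite /chain_step /chain_scale qm => st.
  have {}IH : `|avg_centered_square X (x n) w| <=
      B * V + 576 * (b / Num.sqrt m%:R) * V * g n.
    by apply: IH => k /andP[lk kn]; apply: hk; rewrite lk/= ltnW.
  have -> : avg_centered_square X (x n.+1) w = avg_centered_square X (x n) w +
    (avg_centered_square X (x n.+1) w - avg_centered_square X (x n) w) by ring.
  apply: (le_trans (ler_normD _ _)).
  apply: (le_trans (lerD IH st)); rewrite -addrA lerD2l.
  have gS : g n.+1 = g n + (root2 n * dist n + root2 n.+1 * dist n.+1).
    by rewrite /g (big_nat_recr _ _ _ ln)/=; ring.
  rewrite gS [leRHS]mulrDr lerD2l.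
  apply: (@le_trans _ _ (576 * (b / Num.sqrt m%:R) * V * (root2 n * D n))).
    have := chain_exp_sqrt n; set r := Num.sqrt _ => rle.
    apply: (@le_trans _ _ (2 * (96 * (3 * (root2 n / Num.sqrt m%:R)) * (D n * b)) * V)).
      apply: ler_wpM2r; first exact: ltW.
      apply: ler_wpM2l; first exact: ler0n.
      apply: ler_wpM2r; first exact: ltW (mulr_gt0 (D0 n) b0).
      by apply: ler_wpM2l; first exact: ler0n.
    by rewrite le_eqVlt; apply/orP; left; apply/eqP; ring.
  exact: ler_wpM2l.
move=> /le_trans; apply; rewrite lerD2l.
have g2 : g n <= 2 * gam.
  have h1 := gam_part (leqnn l) (leqW ln) (nN : (n < N.+1)%N).
  have h2 := gam_part (leqnn l) ln (leqW nN).
  by move: h1; rewrite (big_nat_recr _ _ _ ln)/= /g; lra.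
have -> : 1152 * (b * gam / Num.sqrt m%:R) * V =
  576 * (b / Num.sqrt m%:R) * V * (2 * gam) by ring.
exact: ler_wpM2l.
Qed.

(** Induction from the end of the chain, where [x N = t], down to level [n]. A link has squared
    length at most 32 times [V / m * (root2 n * D n) ^+ 2], rounded up to [6 ^+ 2] so that the root
    is explicit. Only [Num.sqrt V] enters, since [V] bounds squared distances. *)
Let fine_scale n : (l <= n <= N)%N ->
  (forall k, (n <= k < N)%N -> (m < chain_exp k)%N) ->
  emp_sqdist X t (x n) w <= (12 * gam * Num.sqrt V / Num.sqrt m%:R) ^+ 2.
Proof.
move=> /andP[ln nN] hk.
(* From level [n.+1] to [n], [f] grows by [root2 n * dist n + root2 n.+1 * dist n.+1], which is at
   least the link [root2 n * D n]. *)
pose f n := root2 n * dist n + 2 * \sum_(n.+1 <= k < N.+1) root2 k * dist k.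
pose c := 6 * Num.sqrt V / Num.sqrt m%:R.
have c0 : 0 < c by rewrite divr_gt0// mulr_gt0// sqrtr_gt0.
have f0 k : 0 < f k.
  apply: (ltr_pwDl (pos k)); apply: mulr_ge0 => //.
  by apply: sumr_ge0 => j _; exact: ltW (pos j).
have : emp_sqdist X t (x n) w <= (c * f n) ^+ 2.
  have [k kE] : exists k, (n + k)%N = N by exists (N - n)%N; rewrite subnKC.
  elim: k n ln nN hk kE => [|k IH] n ln nN hk kE.
    rewrite addn0 in kE; rewrite kE xN /emp_sqdist big1 ?mulr0 ?sqr_ge0// => i _.
    by rewrite subrr expr0n.
  have nN' : (n < N)%N by rewrite -kE -addSnnS leq_addr.
  have := step (n := n); rewrite ln nN' => /(_ isT).
  have qm : (m < chain_exp n)%N by apply: hk; rewrite leqnn.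
  rewrite /chain_step /chain_scale leqNgt qm/= => st.
  have {}IH : emp_sqdist X t (x n.+1) w <= (c * f n.+1) ^+ 2.
    apply: IH; rewrite ?(leqW ln)//; last by rewrite addSnnS.
    by move=> j /andP[nj jN]; apply: hk; rewrite jN ltnW.
  have st2 : emp_sqdist X (x n.+1) (x n) w <= (c * (root2 n * D n)) ^+ 2.
    apply: (le_trans st); rewrite /c /chain_exp natrX -[n.+3]addn3 exprD -root2_sqr.
    have -> : (6 * Num.sqrt V / Num.sqrt m%:R * (root2 n * D n)) ^+ 2 =
      36 * Num.sqrt V ^+ 2 / Num.sqrt m%:R ^+ 2 * (root2 n * D n) ^+ 2.
      by field; rewrite gt_eqF.
    rewrite !sqr_sqrtr ?ler0n ?(ltW V0)//.
    have : 0 <= V / m%:R * (root2 n * D n) ^+ 2.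
      by rewrite mulr_ge0 ?sqr_ge0// divr_ge0 ?(ltW V0).
    rewrite exprMn.
    have -> : 2 * (2 * (root2 n ^+ 2 * 2 ^+ 3 / m%:R) * D n ^+ 2) * V =
      32 * (V / m%:R * (root2 n ^+ 2 * D n ^+ 2)) by ring.
    have -> : 36 * V / m%:R * (root2 n ^+ 2 * D n ^+ 2) =
      36 * (V / m%:R * (root2 n ^+ 2 * D n ^+ 2)) by ring.
    by move: (V / m%:R * _) => y; lra.
  have cD0 : 0 < c * (root2 n * D n) := mulr_gt0 c0 (mulr_gt0 (root2_gt0 n) (D0 n)).
  have := emp_sqdist_triangle (mulr_gt0 c0 (f0 n.+1)) cD0 IH st2.
  move=> /le_trans; apply.
  have cf0 k' := mulr_gt0 c0 (f0 k').
  rewrite ler_pXn2r//; last 2 first.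
  - by rewrite nnegrE ltW// addr_gt0.
  - by rewrite nnegrE ltW.
  rewrite -mulrDr; apply: ler_wpM2l; first exact: ltW.
  have : f n = root2 n * dist n + 2 * (root2 n.+1 * dist n.+1) +
     2 * \sum_(n.+2 <= k < N.+1) root2 k * dist k.
    by rewrite /f big_ltn 1?ltnS//; ring.
  by have := root2D n; rewrite [f n.+1]/f; lra.
move=> /le_trans; apply.
have f2 : f n <= 2 * gam.
  have h1 := gam_part ln (leqW nN) (leqnn _).
  have := pos n; rewrite big_ltn ?ltnS// in h1; rewrite /f; lra.
have -> : 12 * gam * Num.sqrt V / Num.sqrt m%:R = c * (2 * gam) by rewrite /c; ring.
have cf := ler_wpM2l (ltW c0) f2; have cf0 := ltW (mulr_gt0 c0 (f0 n)).
by rewrite ler_pXn2r// nnegrE// (le_trans cf0).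
Qed.

Lemma chain_exp_le n k : (n <= k)%N -> (chain_exp n <= chain_exp k)%N.
Proof. by move=> nk; rewrite leq_exp2l. Qed.

(** If every link is in the Bernstein regime, [coarse] applied at [N] suffices. Otherwise let [n0]
    be the first level outside it: [coarse] controls [A] at [x n0], [fine_scale] the empirical
    distance from there to [t]. *)
Lemma chaining_path :
  `|avg_centered_square X t w| <=
    2400 * (gam ^+ 2 / m%:R + b * gam / Num.sqrt m%:R + B) * V.
Proof.
have bg0 : 0 <= b * gam / Num.sqrt m%:R.
  by rewrite divr_ge0 ?mulr_ge0 ?(ltW b0) ?(ltW sm0).
have gg0 : 0 <= gam ^+ 2 / m%:R by rewrite divr_ge0 ?sqr_ge0.
have B0 : 0 <= B by rewrite -(pmulr_lge0 _ V0) (le_trans _ base).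
have [[n /and3P[ln nN qn]]|no] :=
    pselect (exists n, [&& (l <= n)%N, (n < N)%N & (m < chain_exp n)%N]); last first.
  have := coarse (n := N); rewrite xN lN leqnn => /(_ isT) h.
  apply: (le_trans (h _)).
    move=> k /andP[lk kN]; rewrite leqNgt; apply/negP => qk.
    by apply: no; exists k; rewrite lk kN.
  rewrite -mulrDl ler_wpM2r ?(ltW V0)//; lra.
have ex : exists n, [&& (l <= n)%N, (n < N)%N & (m < chain_exp n)%N].
  by exists n; rewrite ln nN.
case: (ex_minnP ex) => {ln nN qn} n0 /and3P[ln nN qn] nmin.
have hc := coarse (n := n0); rewrite ln (ltnW nN) in hc.
have {}hc := hc isT _.
have {}hc : `|avg_centered_square X (x n0) w| <=
    B * V + 1152 * (b * gam / Num.sqrt m%:R) * V.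
  apply: hc => k /andP[lk kn]; rewrite leqNgt; apply/negP => qk.
  by have := nmin k; rewrite lk (ltn_trans kn nN) qk => /(_ isT); rewrite leqNgt kn.
have hf : emp_sqdist X t (x n0) w <= (12 * gam * Num.sqrt V / Num.sqrt m%:R) ^+ 2.
  apply: fine_scale; first by rewrite ln ltnW.
  by move=> k /andP[nk kN]; apply: (leq_trans qn); exact: chain_exp_le.
(* Since [m] is below [8 * 2 ^ n0], a single term of the sum bounded by [gam] already makes
   [dist n0] of order [gam / sqrt m]. This pays for the difference of the means. *)
have dn0 : dist n0 <= 3 * gam / Num.sqrt m%:R.
  have h1 : root2 n0 * dist n0 <= gam.
    have := gam_part ln (leqnSn _) (ltnW nN).
    by rewrite big_nat1.
  have h2 : Num.sqrt m%:R <= 3 * root2 n0.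
    have : Num.sqrt m%:R ^+ 2 <= (3 * root2 n0) ^+ 2.
      rewrite sqr_sqrtr ?ler0n// exprMn root2_sqr.
      have : m%:R <= (chain_exp n0)%:R :> R by rewrite ler_nat ltnW.
      rewrite /chain_exp natrX -[n0.+3]addn3 exprD.
      have : 0 < 2 ^+ n0 :> R by rewrite exprn_gt0.
      by move: (2 ^+ n0) => y; rewrite !exprS expr0; lra.
    by rewrite ler_pXn2r// nnegrE ltW// mulr_gt0// root2_gt0.
  rewrite ler_pdivlMr//; have := dist0 n0; have := root2_gt0 n0; nra.
have gampos : 0 < gam.
  apply: lt_le_trans (pos n0) _; have := gam_part ln (leqnSn _) (ltnW nN).
  by rewrite big_nat1.
have a0 : 0 < 12 * gam * Num.sqrt V / Num.sqrt m%:R.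
  by rewrite divr_gt0// !mulr_gt0 ?sqrtr_gt0.
have := avg_centered_square_dist a0 b0 (xb n0) hf.
move=> /le_trans; apply.
have mu := avg_mean_square_dist m0 (tx n0) tb (xb n0).
have hmu : 2 * dist n0 * b <= 6 * (b * gam / Num.sqrt m%:R) * V.
  apply: (@le_trans _ _ (6 * (b * gam / Num.sqrt m%:R))); last first.
    by rewrite ler_peMr// mulr_ge0.
  apply: (@le_trans _ _ (2 * (3 * gam / Num.sqrt m%:R) * b)).
    by rewrite ler_wpM2r ?(ltW b0)// ler_wpM2l.
  by rewrite le_eqVlt; apply/orP; left; apply/eqP; ring.
have ha : 2 * (12 * gam * Num.sqrt V / Num.sqrt m%:R) ^+ 2 = 288 * (gam ^+ 2 / m%:R) * V.
  have -> : (12 * gam * Num.sqrt V / Num.sqrt m%:R) ^+ 2 =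
    144 * gam ^+ 2 * Num.sqrt V ^+ 2 / Num.sqrt m%:R ^+ 2 by field; rewrite gt_eqF.
  by rewrite !sqr_sqrtr ?ler0n ?(ltW V0)//; ring.
have hab : 2 * (12 * gam * Num.sqrt V / Num.sqrt m%:R) * b <= 24 * (b * gam / Num.sqrt m%:R) * V.
  have sV : Num.sqrt V <= V.
    have s1 : 1 <= Num.sqrt V by rewrite -sqrtr1 ler_wsqrtr.
    by rewrite -[leRHS]sqr_sqrtr ?(ltW V0)// expr2 ler_peMr ?sqrtr_ge0.
  have -> : 2 * (12 * gam * Num.sqrt V / Num.sqrt m%:R) * b =
    24 * (b * gam / Num.sqrt m%:R) * Num.sqrt V by ring.
  by rewrite ler_wpM2l// mulr_ge0.
rewrite ha.
(* The largest coefficient is that of [b * gam / Num.sqrt m%:R], namely [2 * 1152 + 24 + 6]. *)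
have -> : 2400 * (gam ^+ 2 / m%:R + b * gam / Num.sqrt m%:R + B) * V =
  2400 * (gam ^+ 2 / m%:R * V) + 2400 * (b * gam / Num.sqrt m%:R * V) + 2400 * (B * V) by ring.
have y1 : 0 <= gam ^+ 2 / m%:R * V by rewrite mulr_ge0// ltW.
have y2 : 0 <= b * gam / Num.sqrt m%:R * V by rewrite mulr_ge0// ltW.
have y3 : 0 <= B * V by rewrite mulr_ge0// ltW.
move: hc mu hmu hab; rewrite -!mulrA in y1 y2 y3 *.
by lra.
Qed.

End one_path.

End chaining.

(** * Finite index sets: enumeration and suprema *)

Lemma card_le_enum (U : Type) (A : set U) (n : nat) (x0 : U) :
  (A #<= `I_n)%card -> A x0 ->
  exists e : 'I_n -> U, (forall a, A (e a)) /\ (forall x, A x -> exists a, e a = x).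
Proof.
move=> /pcard_leP[f] Ax0.
pose e (a : 'I_n) := match pselect (exists x, A x /\ f x = a :> nat) with
  | left h => sval (cid h) | right _ => x0 end.
exists e; split.
  by move=> a; rewrite /e; case: pselect => // h; case: (svalP (cid h)).
move=> x Ax; have fx : (f x < n)%N := @funS _ _ _ _ f x Ax.
exists (Ordinal fx); rewrite /e; case: pselect => [h|[]]; last by exists x.
case: (svalP (cid h)) => Ay /= fy.
by apply: (inj (f := f)); rewrite ?inE.
Qed.

Lemma finite_enum (U : Type) (A : set U) : finite_set A -> A !=set0 ->
  exists n (e : 'I_n -> U), (forall a, A (e a)) /\ (forall x, A x -> exists a, e a = x).
Proof.
move=> /finite_setP[n /card_eqPle[An _]] [x0 Ax0].
by exists n; exact: card_le_enum An Ax0.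
Qed.

Section finite_sup.
Context (R : realType) (U : Type).

Lemma sup_finite_le (A : set U) (f : U -> R) (c : R) : A !=set0 ->
  (forall x, A x -> f x <= c) -> sup [set f x | x in A] <= c.
Proof.
move=> [x0 Ax0] h; apply: ge_sup; first by exists (f x0), x0.
by move=> _ [x Ax <-]; exact: h.
Qed.

Lemma sup_finite_ge (A : set U) (f : U -> R) x : finite_set A -> A x ->
  f x <= sup [set f x | x in A].
Proof.
move=> fA Ax; apply: ub_le_sup; last by exists x.
have [n [e [_ eA]]] : exists n (e : 'I_n -> U),
    (forall a, A (e a)) /\ (forall x, A x -> exists a, e a = x).
  by apply: finite_enum => //; exists x.
exists (\sum_(a < n) `|f (e a)|) => _ [y Ay <-].
have [a <-] := eA _ Ay.
rewrite (bigD1 a)//= (le_trans (ler_norm _))// lerDl.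
by apply: sumr_ge0 => i _.
Qed.

Lemma sup_finite_attained (A : set U) (f : U -> R) : finite_set A -> A !=set0 ->
  exists2 x, A x & sup [set f x | x in A] = f x.
Proof.
move=> fA A0; have [n [e [Ae eA]]] := finite_enum fA A0.
have [x0 Ax0] := A0; have [a0 _] := eA _ Ax0.
case: (@Order.TotalTheory.arg_maxP _ _ _ a0 xpredT (fun a => f (e a)) isT) => a _ amax.
exists (e a) => //; apply/eqP; rewrite eq_le sup_finite_ge// andbT.
apply: sup_finite_le => // x Ax; have [b <-] := eA _ Ax.
exact: amax.
Qed.

Lemma measurable_finite_sup d (T : measurableType d) (A : set U) (f : U -> T -> R) :
  finite_set A -> A !=set0 -> (forall x, measurable_fun setT (f x)) ->
  measurable_fun setT (fun w => sup [set f x w | x in A]).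
Proof.
move=> fA A0 mf; have [n [e [Ae eA]]] := finite_enum fA A0.
have [x0 Ax0] := A0; have [a0 _] := eA _ Ax0.
rewrite (_ : (fun w => _) =
    (fun w => \big[Num.max/f (e a0) w]_(a <- enum 'I_n) f (e a) w)).
  elim: (enum 'I_n) => [|a s IH].
    by under eq_fun do rewrite big_nil; exact: mf.
  by under eq_fun do rewrite big_cons; apply: measurable_maxr.
apply/funext => w; apply/eqP; rewrite eq_le; apply/andP; split.
  apply: sup_finite_le => // x Ax; have [a <-] := eA _ Ax.
  apply: (@Order.TotalTheory.le_bigmax_seq _ _ _ (enum 'I_n) _ a xpredT
    (fun a => f (e a) w)) => //.
  by rewrite mem_enum.
by apply: bigmax_le => [|a _]; exact: sup_finite_ge.
Qed.

End finite_sup.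

Lemma integral_sum_le (R : realType) d (T : measurableType d)
    (mu : measure T R) (I : Type) (s : seq I) (f : I -> T -> R) (c : I -> R) :
  (forall i, measurable_fun setT (f i)) -> (forall i w, 0 <= f i w) ->
  (forall i, (\int[mu]_w (f i w)%:E <= (c i)%:E)%E) ->
  (\int[mu]_w (\sum_(i <- s) f i w)%:E <= (\sum_(i <- s) c i)%:E)%E.
Proof.
move=> mf f0 fc; under eq_integral do rewrite -sumEFin.
rewrite ge0_integral_sum//; last 2 first.
- by move=> i; apply/measurable_EFinP.
- by move=> i w _; rewrite lee_fin.
by rewrite -sumEFin; apply: lee_sum.
Qed.

Lemma half_pow_le (R : realType) (a b c : nat) : (a + c <= b)%N ->
  2 ^+ a * 2^-1 ^+ b <= 2^-1 ^+ c :> R.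
Proof.
move=> /subnKC <-; rewrite !exprD !mulrA -exprMn divff ?pnatr_eq0// expr1n mul1r.
rewrite ler_piMr ?exprn_ge0// exprn_ile1//; lra.
Qed.

Lemma integral_scaled_power (R : realType) d (T : measurableType d)
    (mu : measure T R) (f : T -> R) (c : R) (q : nat) :
  measurable_fun setT f -> (forall w, 0 <= f w) -> 0 < c ->
  (\int[mu]_w (f w ^+ q)%:E <= (c ^+ q)%:E)%E ->
  (\int[mu]_w ((f w / (2 * c)) ^+ q)%:E <= (2^-1 ^+ q)%:E)%E.
Proof.
move=> mf f0 c0 fc.
have c20 : 0 < 2 * c by rewrite mulr_gt0.
under eq_integral do rewrite mulrC exprMn EFinM.
rewrite ge0_integralZl_EFin//; last 3 first.
- by move=> w _; rewrite lee_fin exprn_ge0.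
- by apply/measurable_EFinP; exact: measurable_funX.
- by rewrite exprn_ge0// invr_ge0 ltW.
apply: (le_trans (lee_wpmul2l _ fc)).
  by rewrite lee_fin exprn_ge0// invr_ge0 ltW.
rewrite -EFinM -exprMn lee_fin le_eqVlt; apply/orP; left; apply/eqP.
by congr (_ ^+ q); field; rewrite gt_eqF.
Qed.

(** * The random weight that controls all chains at once *)

Section chain_weight.
Context (R : realType) (m : nat) (d : 'I_m -> measure_display)
  (Omega : forall i, measurableType (d i))
  (P : forall i, probability (Omega i) R)
  (Q : probability (dprod Omega) R)
  (S : 'I_m -> Type) (X : forall i, S i -> {RV (P i) >-> R}).
Hypotheses (m0 : (0 < m)%N) (PQ : is_product_probability P Q).
Implicit Types (u v t : forall i, S i) (w : dprod Omega) (n k : nat).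

Lemma chain_exp_gt0 n : (0 < chain_exp n)%N.
Proof. by rewrite expn_gt0. Qed.

Lemma chain_scale_gt0 (b : R) n (a : R) : 0 < a -> 0 < b -> 0 < chain_scale m b n a.
Proof.
have q0 : 0 < (chain_exp n)%:R / m%:R :> R by rewrite divr_gt0 ?ltr0n ?chain_exp_gt0.
move=> a0 b0; rewrite /chain_scale; case: ifP => _.
  by apply: mulr_gt0; [apply: mulr_gt0; rewrite ?sqrtr_gt0|exact: mulr_gt0].
by apply: mulr_gt0; [exact: mulr_gt0|exact: exprn_gt0].
Qed.

Lemma chain_step_ge0 n u v w : 0 <= chain_step X n u v w.
Proof. by rewrite /chain_step; case: ifP => // _; exact: emp_sqdist_ge0. Qed.

Lemma measurable_chain_step n u v : measurable_fun setT (chain_step X n u v).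
Proof.
rewrite /chain_step; case: (leqP (chain_exp n) m) => _; last exact: (measurable_emp_sqdist X u v).
apply: measurableT_comp => //.
by apply: measurable_funB; exact: measurable_avg_centered_square.
Qed.

Lemma chain_step_moment n u v (a b : R) :
  psi2_dist_le X u v a -> psi2_radius_le X u b -> psi2_radius_le X v b ->
  (\int[Q]_w (chain_step X n u v w ^+ chain_exp n)%:E <=
    (chain_scale m b n a ^+ chain_exp n)%:E)%E.
Proof.
move=> uv ub vb; rewrite /chain_step /chain_scale.
have [qm|mq] := leqP (chain_exp n) m.
  exact: (increment_moment m0 PQ uv ub vb (chain_exp_gt0 n) qm).
exact: (emp_sqdist_moment m0 PQ uv (ltnW mq)).
Qed.

Variables (l N : nat) (e : forall n, 'I_(2 ^ (2 ^ n)) -> forall i, S i)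
  (D : (forall i, S i) -> (forall i, S i) -> R) (b B : R).
Hypotheses (lN : (l <= N)%N) (b0 : 0 < b) (B0 : 0 < B)
  (D0 : forall u v, 0 < D u v)
  (eb : forall n a, psi2_radius_le X (@e n a) b)
  (eD : forall n a n' a', psi2_dist_le X (@e n a) (@e n' a')
          (D (@e n a) (@e n' a')))
  (baseB : forall a, (\int[Q]_w (`|avg_centered_square X (@e l a) w| ^+ chain_exp l)%:E
     <= (B ^+ chain_exp l)%:E)%E).

Let base_term (a : 'I_(2 ^ (2 ^ l))) w :=
  (`|avg_centered_square X (@e _ a) w| / (2 * B)) ^+ chain_exp l.

Let step_term n (ab : 'I_(2 ^ (2 ^ n.+1)) * 'I_(2 ^ (2 ^ n))) w :=
  (chain_step X n (@e _ ab.1) (@e _ ab.2) w /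
    (2 * chain_scale m b n (D (@e _ ab.1) (@e _ ab.2)))) ^+ chain_exp n.

Let step_sum n w := \sum_ab step_term (n := n) ab w.

(* Every term is raised to a power at least [p] and normalized by twice its
   moment bound, so that its expectation beats the number of links of its level,
   while the unnormalized term is at most [2 * scale * chain_weight w `^ p^-1]. *)
Definition chain_weight w : R :=
  1 + (\sum_a base_term a w + \sum_(l <= n < N) step_sum n w).

Let base_term_ge0 a w : 0 <= base_term a w.
Proof. by rewrite exprn_ge0// divr_ge0// mulr_ge0// ltW. Qed.

Let step_term_ge0 n ab w : 0 <= step_term (n := n) ab w.
Proof.
rewrite exprn_ge0// divr_ge0 ?chain_step_ge0// mulr_ge0// ltW//.
exact: chain_scale_gt0.
Qed.

Let step_sum_ge0 n w : 0 <= step_sum n w.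
Proof. by apply: sumr_ge0 => ab _. Qed.

Let measurable_base_term a : measurable_fun setT (base_term a).
Proof.
apply: measurable_funX; apply: measurable_funM => //.
by apply: measurableT_comp => //; exact: measurable_avg_centered_square.
Qed.

Let measurable_step_term n ab : measurable_fun setT (step_term (n := n) ab).
Proof.
by apply: measurable_funX; apply: measurable_funM => //; exact: measurable_chain_step.
Qed.

Let measurable_step_sum n : measurable_fun setT (step_sum n).
Proof. by apply: measurable_sum => ab. Qed.

Lemma measurable_chain_weight : measurable_fun setT chain_weight.
Proof.
apply: measurable_funD => //; apply: measurable_funD.
  exact: measurable_sum.
exact: measurable_sum.
Qed.

Lemma chain_weight_ge1 w : 1 <= chain_weight w.
Proof.
by rewrite lerDl addr_ge0// sumr_ge0.
Qed.

Lemma chain_weight_base a w :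
  (`|avg_centered_square X (@e l a) w| / (2 * B)) ^+ chain_exp l <= chain_weight w.
Proof.
rewrite -/(base_term a w) /chain_weight (bigD1 a)//= addrCA -addrA lerDl.
by rewrite !addr_ge0// sumr_ge0.
Qed.

Lemma chain_weight_step n a a' w : (l <= n < N)%N ->
  (chain_step X n (@e n.+1 a) (@e n a') w /
    (2 * chain_scale m b n (D (@e _ a) (@e _ a')))) ^+ chain_exp n <= chain_weight w.
Proof.
move=> lnN; rewrite -/(step_term (a, a') w).
apply: (@le_trans _ _ (step_sum n w)).
  by rewrite /step_sum (bigD1 (a, a'))//= lerDl sumr_ge0.
apply: (@le_trans _ _ (\sum_(l <= n < N) step_sum n w)).
  by rewrite (bigD1_seq n) ?mem_index_iota ?iota_uniq//= lerDl sumr_ge0.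
by rewrite /chain_weight addrA lerDr addr_ge0// sumr_ge0.
Qed.

Let base_count : \sum_(a : 'I_(2 ^ (2 ^ l))) (2^-1 : R) ^+ chain_exp l <= 1.
Proof.
rewrite sumr_const card_ord -[leLHS]mulr_natl natrX.
apply: (@half_pow_le R _ _ 0); rewrite addn0.
by rewrite leq_exp2l// -[l.+3]addn3 leq_addr.
Qed.

(** There are [2^(3 * 2^n)] pairs and each contributes [2^(-8 * 2^n)]; the margin [5 * 2^n] in the
    exponent exceeds [n + 1], which makes the levels summable with total at most 1. *)
Let step_count n :
  \sum_(ab : 'I_(2 ^ (2 ^ n.+1)) * 'I_(2 ^ (2 ^ n))) (2^-1 : R) ^+ chain_exp n <=
    2^-1 ^+ n.+1.
Proof.
rewrite sumr_const card_prod !card_ord -expnD -[leLHS]mulr_natl natrX.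
apply: half_pow_le; rewrite /chain_exp.
have : (n < 2 ^ n)%N by rewrite ltn_expl.
rewrite !expnS => n2.
have h : (n.+1 <= 2 ^ n)%N := n2.
apply: (@leq_trans (2 * 2 ^ n + 2 ^ n + 2 ^ n)%N); first by rewrite leq_add2l.
by move: (2 ^ n)%N => x; rewrite !mulnA -[X in (_ * _ + X + X)%N]mul1n -!mulnDl leq_mul2r orbT.
Qed.

Lemma chain_weight_mean : (\int[Q]_w (chain_weight w)%:E <= 3%:E)%E.
Proof.
have hb : (\int[Q]_w (\sum_a base_term a w)%:E <= 1%:E)%E.
  apply: (@le_trans _ _ (\sum_(a : 'I_(2 ^ (2 ^ l))) (2^-1 : R) ^+ chain_exp l)%:E).
    apply: integral_sum_le => // a; apply: integral_scaled_power => //.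
    by apply: measurableT_comp => //; exact: measurable_avg_centered_square.
  by rewrite lee_fin.
have hs n : (\int[Q]_w (step_sum n w)%:E <= (2^-1 ^+ n.+1)%:E)%E.
  apply: (@le_trans _ _
    (\sum_(ab : 'I_(2 ^ (2 ^ n.+1)) * 'I_(2 ^ (2 ^ n))) (2^-1 : R) ^+ chain_exp n)%:E).
    apply: integral_sum_le => // ab; apply: integral_scaled_power.
    - exact: measurable_chain_step.
    - by move=> w; exact: chain_step_ge0.
    - exact: chain_scale_gt0.
    - exact: chain_step_moment.
  by rewrite lee_fin.
have hS : (\int[Q]_w (\sum_(l <= n < N) step_sum n w)%:E <= 1%:E)%E.
  apply: (@le_trans _ _ (\sum_(l <= n < N) (2^-1 : R) ^+ n.+1)%:E).
    exact: integral_sum_le.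
  rewrite lee_fin; apply: (@le_trans _ _ (\sum_(0 <= n < N) (2^-1 : R) ^+ n.+1)).
    rewrite [leRHS](big_cat_nat (leq0n l) lN)/= lerDr.
    by apply: sumr_ge0 => i _; rewrite exprn_ge0.
  under eq_bigr do rewrite exprS.
  by rewrite -mulr_sumr; have := sum_half_le R N; lra.
rewrite /chain_weight.
under eq_integral do rewrite 2!EFinD.
have mb : measurable_fun setT (fun w => \sum_a base_term a w) by exact: measurable_sum.
have ms : measurable_fun setT (fun w => \sum_(l <= n < N) step_sum n w).
  exact: measurable_sum.
have sb0 w : (0 <= (\sum_a base_term a w)%:E)%E by rewrite lee_fin sumr_ge0.
have ss0 w : (0 <= (\sum_(l <= n < N) step_sum n w)%:E)%E by rewrite lee_fin sumr_ge0.
rewrite ge0_integralD//; last 2 first.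
- by move=> w _; rewrite adde_ge0.
- by apply: emeasurable_funD; apply/measurable_EFinP.
rewrite ge0_integralD//; last 2 first.
- by apply/measurable_EFinP.
- by apply/measurable_EFinP.
rewrite integral_cst// mul1e.
rewrite [X in (X + _)%E](@probability_setT _ _ _ Q).
rewrite (_ : 3%:E = 1 + (1 + 1) :> \bar R)%E; last by rewrite -!EFinD; congr EFin; lra.
by rewrite leeD2l// leeD.
Qed.

End chain_weight.

(** If [y] exceeded the p-th root of [W], it would exceed 1, and then [y ^+ q] would be at least [y]
    to the power [p], hence above [W]. This is where the leading 1 of [chain_weight] matters. *)
Lemma le_root_of_expr_le (R : realType) (y W p : R) (q : nat) :
  0 <= y -> 1 <= W -> 1 <= p -> p <= q%:R -> y ^+ q <= W -> y <= W `^ p^-1.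
Proof.
move=> y0 W1 p1 pq yW.
have p0 : 0 < p by apply: lt_le_trans p1.
have W0 : 0 < W by apply: lt_le_trans W1.
rewrite leNgt; apply/negP => h.
have V1 : 1 <= W `^ p^-1.
  rewrite (_ : 1 = 1 `^ p^-1); last by rewrite powR1.
  by rewrite ge0_ler_powR ?nnegrE ?invr_ge0 ?(ltW p0) ?(ltW W0).
have y1 : 1 <= y by apply: le_trans V1 (ltW h).
have : W < y ^+ q.
  apply: (@lt_le_trans _ _ (y `^ p)).
    have -> : W = (W `^ p^-1) `^ p by rewrite -powRrM mulVf ?gt_eqF// powRr1 ?(ltW W0).
    by rewrite gt0_ltr_powR// nnegrE// powR_ge0.
  by rewrite -powR_mulrn// ler_powR.
by rewrite ltNge yW.
Qed.

(** * Moment bound for a given finite chain *)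

Section chaining_moment.
Context (R : realType) (m : nat) (d : 'I_m -> measure_display)
  (Omega : forall i, measurableType (d i))
  (P : forall i, probability (Omega i) R)
  (Q : probability (dprod Omega) R)
  (S : 'I_m -> Type) (X : forall i, S i -> {RV (P i) >-> R}).
Hypotheses (m0 : (0 < m)%N) (PQ : is_product_probability P Q).
Variables (T : set (forall i, S i)) (l N : nat)
  (e : forall n, 'I_(2 ^ (2 ^ n)) -> forall i, S i)
  (D : (forall i, S i) -> (forall i, S i) -> R) (b sigma K p gam : R).
Hypotheses (fT : finite_set T) (T0 : T !=set0) (lN : (l <= N)%N) (b0 : 0 < b)
  (sigma0 : 0 < sigma) (K0 : 0 < K) (p1 : 1 <= p)
  (lp : p <= (chain_exp l)%:R) (pl : (chain_exp l)%:R <= 8 * p)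
  (D0 : forall u v, 0 < D u v)
  (Ttri : forall t u v, T t -> T u -> T v -> D u v <= D t u + D t v)
  (Tb : forall t, T t -> psi2_radius_le X t b)
  (TD : forall u v, T u -> T v -> psi2_dist_le X u v (D u v))
  (eT : forall n a, T (@e n a))
  (cover : forall t, T t -> exists2 j : forall n, 'I_(2 ^ (2 ^ n)),
     @e N (j N) = t & \sum_(l <= n < N.+1) root2 R n * D t (@e n (j n)) <= gam)
  (mom : forall t k, T t -> (avg_moment X k.+2 t <=
    (k.+2`!%:R / 2 * sigma ^+ 2 * K ^+ k)%:E)%E).

Let base := 8 * (Num.sqrt (chain_exp l)%:R * (sigma / Num.sqrt m%:R) +
  2 * (chain_exp l)%:R * (K / m%:R)).

Definition chaining_bound : R := gam ^+ 2 / m%:R + b * gam / Num.sqrt m%:R +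
  Num.sqrt p * (sigma / Num.sqrt m%:R) + p * (K / m%:R).

Let mpos : 0 < m%:R :> R. Proof. by rewrite ltr0n. Qed.
Let sm0 : 0 < Num.sqrt m%:R :> R. Proof. by rewrite sqrtr_gt0. Qed.
Let two0 : 0 < 2 :> R. Proof. by rewrite ltr0n. Qed.
Let p0 : 0 < p. Proof. exact: lt_le_trans p1. Qed.
Let s0 : 0 < sigma / Num.sqrt m%:R. Proof. exact: divr_gt0. Qed.
Let k0 : 0 < K / m%:R. Proof. exact: divr_gt0. Qed.

Let base0 : 0 < base.
Proof.
have q0 : 0 < (chain_exp l)%:R :> R by rewrite ltr0n chain_exp_gt0.
apply: mulr_gt0; first by rewrite ltr0n.
apply: addr_gt0; first by rewrite mulr_gt0// sqrtr_gt0.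
by rewrite mulr_gt0// mulr_gt0.
Qed.

(** With [q = chain_exp l <= 8 * p], the root of [q] is at most [3 * Num.sqrt p]; the two
    coefficients become [16 * 3] and [16 * 2 * 8 = 256]. *)
Let base_le : 2 * base <=
  256 * (Num.sqrt p * (sigma / Num.sqrt m%:R) + p * (K / m%:R)).
Proof.
have sq : Num.sqrt (chain_exp l)%:R <= 3 * Num.sqrt p.
  apply: (@le_trans _ _ (Num.sqrt (3 ^+ 2 * p))).
    by rewrite ler_wsqrtr// (le_trans pl)// ler_wpM2r ?(ltW p0)//; rewrite !exprS expr0; lra.
  by rewrite sqrtrM// sqrtr_sqr ger0_norm.
rewrite /base; move: sq pl s0 k0.
move: (sigma / _) (K / _) (chain_exp l)%:R (Num.sqrt (chain_exp l)%:R) => s k y x xp yp s0' k0'.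
have h1 : x * s <= 3 * Num.sqrt p * s by rewrite ler_wpM2r ?(ltW s0').
have h2 : y * k <= 8 * p * k by rewrite ler_wpM2r ?(ltW k0').
have h3 : 0 <= Num.sqrt p * s by rewrite mulr_ge0 ?sqrtr_ge0 ?(ltW s0').
have h4 : 0 <= p * k by rewrite mulr_ge0 ?(ltW p0) ?(ltW k0').
by move: h1 h2; rewrite -!mulrA; lra.
Qed.

Let wt := chain_weight X l N e D b base.

Let gam0 : 0 <= gam.
Proof.
have [t Tt] := T0; have [j _ h] := cover Tt.
apply: le_trans h; apply: sumr_ge0 => n _.
by rewrite mulr_ge0 ?(ltW (D0 _ _))// ltW// root2_gt0.
Qed.

Lemma chaining_bound_gt0 : 0 < chaining_bound.
Proof.
apply: ltr_pwDr; first exact: mulr_gt0.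
apply: addr_ge0; last by rewrite mulr_ge0 ?sqrtr_ge0 ?(ltW s0).
apply: addr_ge0; first by rewrite divr_ge0 ?sqr_ge0.
by rewrite divr_ge0 ?sqrtr_ge0// mulr_ge0// ltW.
Qed.

(** The weight does not depend on [t], so the supremum over [T] can be taken before integrating. *)
Let pointwise t w : T t ->
  `|avg_centered_square X t w| <= 2400 * (256 * chaining_bound) * wt w `^ p^-1.
Proof.
move=> Tt; have [j jN jgam] := cover Tt.
have W1 : 1 <= wt w := chain_weight_ge1 X m0 l N e b0 base0 D0 w.
have V1 : 1 <= wt w `^ p^-1.
  rewrite (_ : 1 = 1 `^ p^-1); last by rewrite powR1.
  by rewrite ge0_ler_powR ?nnegrE ?invr_ge0 ?(ltW p0)// (le_trans _ W1).
have pq n : (l <= n)%N -> p <= (chain_exp n)%:R.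
  by move=> ln; rewrite (le_trans lp)// ler_nat chain_exp_le.
apply: (@le_trans _ _
  (2400 * (gam ^+ 2 / m%:R + b * gam / Num.sqrt m%:R + 2 * base) * wt w `^ p^-1)).
  apply: (chaining_path m0 (x := fun n => @e n (j n)) (l := l) (N := N)
    (dist := fun n => D t (@e n (j n)))
    (D := fun n => D (@e n.+1 (j n.+1)) (@e n (j n)))) => //.
  - by move=> n; rewrite addrC; exact: Ttri.
  - exact: Tb.
  - by move=> n; exact: Tb.
  - by move=> n; exact: TD.
  - have h := chain_weight_base X m0 N e b0 base0 D0 (j l) w.
    have c0 : 0 < 2 * base := mulr_gt0 two0 base0.
    have := le_root_of_expr_le (divr_ge0 (normr_ge0 _) (ltW c0)) W1 p1 lp h.
    by rewrite ler_pdivrMr// [leRHS]mulrC.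
  - move=> n lnN; have /andP[ln _] := lnN.
    have h := chain_weight_step X m0 e b0 base0 D0 (j n.+1) (j n) w lnN.
    have sc := chain_scale_gt0 m0 n (D0 (@e n.+1 (j n.+1)) (@e n (j n))) b0.
    have c0 := mulr_gt0 two0 sc.
    have := le_root_of_expr_le (divr_ge0 (chain_step_ge0 _ _ _ _ _) (ltW c0)) W1 p1 (pq n ln) h.
    by rewrite ler_pdivrMr// [leRHS]mulrC.
apply: ler_wpM2r; first exact: powR_ge0.
apply: ler_wpM2l; first exact: ler0n.
have x0 : 0 <= gam ^+ 2 / m%:R by rewrite divr_ge0 ?sqr_ge0.
have y0 : 0 <= b * gam / Num.sqrt m%:R.
  by rewrite divr_ge0 ?sqrtr_ge0// mulr_ge0// ltW.
move: base_le; rewrite /chaining_bound.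
move: (gam ^+ 2 / _) (b * gam / _) (Num.sqrt p * _) (p * _) x0 y0 base => x y z k x0 y0 B.
lra.
Qed.

Lemma chaining_moment :
  (\int[Q]_w (sup [set `|avg_centered_square X t w| `^ p | t in T])%:E <=
    (3 * (2400 * (256 * chaining_bound)) `^ p)%:E)%E.
Proof.
have c0 : 0 <= 2400 * (256 * chaining_bound).
  by do 2!(apply: mulr_ge0; first exact: ler0n); exact: ltW chaining_bound_gt0.
have pw := pointwise.
move: (2400 * (256 * chaining_bound)) c0 pw => C c0 pw.
have mW : measurable_fun setT wt by exact: measurable_chain_weight.
have W1 w : 1 <= wt w := chain_weight_ge1 X m0 l N e b0 base0 D0 w.
apply: (@le_trans _ _ (\int[Q]_w ((C `^ p)%:E * (wt w)%:E))%E).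
  apply: ge0_le_integral; first exact: measurableT.
  - move=> w _; rewrite lee_fin; have [t Tt] := T0.
    apply: le_trans (sup_finite_ge (fun t => `|avg_centered_square X t w| `^ p) fT Tt).
    exact: powR_ge0.
  - apply/measurable_EFinP; apply: measurable_finite_sup => // t.
    apply: (measurableT_comp (f := fun x : R => x `^ p)) => //.
    by apply: measurableT_comp => //; exact: measurable_avg_centered_square.
  - by apply: emeasurable_funM => //; apply/measurable_EFinP.
  move=> w _; rewrite -EFinM lee_fin.
  apply: sup_finite_le => // t Tt.
  have -> : wt w = (wt w `^ p^-1) `^ p.
    by rewrite -powRrM mulVf ?gt_eqF// powRr1// (le_trans _ (W1 w)).
  rewrite -powRM ?powR_ge0//.
  apply: ge0_ler_powR; rewrite ?nnegrE.
  - exact: ltW.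
  - exact: normr_ge0.
  - by apply: mulr_ge0 => //; exact: powR_ge0.
  - exact: pw.
rewrite ge0_integralZl_EFin ?powR_ge0//; last 2 first.
- by move=> w _; rewrite lee_fin (le_trans _ (W1 w)).
- by apply/measurable_EFinP.
rewrite mulrC EFinM lee_wpmul2l ?lee_fin ?powR_ge0//.
apply: chain_weight_mean => //.
- by move=> n a; exact: Tb.
- by move=> n a n' a'; exact: TD.
move=> a; apply: (base_moment m0 PQ (Tb (eT a)) sigma0 K0 (chain_exp_gt0 l)).
by move=> k; exact: mom.
Qed.

End chaining_moment.

(** * From the [gamma_2] functional to a finite chain *)

Section psi2_metric.
Context (R : realType) (m : nat) (d : 'I_m -> measure_display)
  (Omega : forall i, measurableType (d i))
  (P : forall i, probability (Omega i) R)
  (S : 'I_m -> Type) (X : forall i, S i -> {RV (P i) >-> R}).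
Hypothesis m0 : (0 < m)%N.
Implicit Types (u v t : forall i, S i).

Let mX i (x : S i) : measurable_fun setT (X x : Omega i -> R).
Proof. exact: measurable_funP. Qed.

Lemma subgaussian_psi2_le i (x : S i) : subgaussian (P i) (X x) ->
  exists a, psi2_le (P i) (X x) a.
Proof.
move=> /ereal_inf_lt[_ [a [a0 /psi2_norm_setE xa] _] _].
by exists a.
Qed.

Lemma d_psi2_lt u v a : (d_psi2 X u v < a%:E)%E -> psi2_dist_le X u v a.
Proof.
move=> uva i; apply: psi2_norm_lt; first by apply: measurable_funB; exact: mX.
apply: le_lt_trans uva.
exact: (@Order.TotalTheory.le_bigmax _ _ _ _
  (fun i => psi2_norm (P i) (fun w => X (u i) w - X (v i) w))).
Qed.

Lemma d_psi2_le u v a : psi2_dist_le X u v a -> (d_psi2 X u v <= a%:E)%E.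
Proof.
by move=> h; apply: bigmax_le => [|i _]; [exact: leNye|exact: psi2_le_norm].
Qed.

Lemma d_psi2_ge0 u v : (0 <= d_psi2 X u v)%E.
Proof.
apply: (@le_trans _ _ (psi2_norm (P (Ordinal m0)) (fun w => X (u _) w - X (v _) w))).
  exact: psi2_norm_ge0.
exact: (@Order.TotalTheory.le_bigmax _ _ _ _
  (fun i => psi2_norm (P i) (fun w => X (u i) w - X (v i) w))).
Qed.

Lemma psi2_le_sub i (x y : S i) a b :
  psi2_le (P i) (X x) a -> psi2_le (P i) (X y) b ->
  psi2_le (P i) (fun w => X x w - X y w) (a + b).
Proof.
move=> xa yb; apply: (psi2_leD (Y := fun w => - X y w)).
- exact: mX.
- by apply: measurableT_comp => //; exact: mX.
- exact: xa.
- exact: psi2_leN.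
Qed.

Section index_set.
Variable T : set (forall i, S i).
Hypotheses (fT : finite_set T) (T0 : T !=set0)
  (sgT : forall t, T t -> forall i, subgaussian (P i) (X (t i))).

Lemma d_psi2_fin u v : T u -> T v -> d_psi2 X u v \is a fin_num.
Proof.
move=> Tu Tv; rewrite ge0_fin_numE ?d_psi2_ge0//.
apply: bigmax_lt => [|i _]; first by [].
have [a ua] := subgaussian_psi2_le (sgT Tu i).
have [b vb] := subgaussian_psi2_le (sgT Tv i).
by apply: le_lt_trans (psi2_le_norm (psi2_le_sub ua vb)) _; rewrite ltry.
Qed.

Let dist u v : R := fine (d_psi2 X u v).

Let dist_ge0 u v : 0 <= dist u v.
Proof. by rewrite fine_ge0// d_psi2_ge0. Qed.

Let dist_psi2_le u v a : T u -> T v -> dist u v < a -> psi2_dist_le X u v a.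
Proof.
move=> Tu Tv uva; apply: d_psi2_lt.
by rewrite -(fineK (d_psi2_fin Tu Tv)) lte_fin.
Qed.

Let psi2_le_dist u v a : T u -> T v -> psi2_dist_le X u v a -> dist u v <= a.
Proof.
move=> Tu Tv uva; rewrite -lee_fin fineK ?d_psi2_fin//.
exact: d_psi2_le.
Qed.

(** With [t] first in both terms the statement includes the symmetry needed to pass through [t]. The
    slack [e] is split in two halves because the norms are infima. *)
Lemma d_psi2_triangle t u v : T t -> T u -> T v ->
  fine (d_psi2 X u v) <= fine (d_psi2 X t u) + fine (d_psi2 X t v).
Proof.
move=> Tt Tu Tv; apply/ler_addgt0Pr => e e0; apply: psi2_le_dist => // i.
have e2 : 0 < e / 2 by rewrite divr_gt0.
have tu := dist_psi2_le Tt Tu (_ : dist t u < dist t u + e / 2) i.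
have tv := dist_psi2_le Tt Tv (_ : dist t v < dist t v + e / 2) i.
rewrite (_ : _ + _ + e = (dist t u + e / 2) + (dist t v + e / 2)); last first.
  by rewrite -/(dist t u) -/(dist t v); move: (dist t u) (dist t v) => x y; field.
rewrite (_ : (fun w => X (u i) w - X (v i) w) =
  (fun w => - (X (t i) w - X (u i) w) + (X (t i) w - X (v i) w))); last first.
  by apply/funext => w; rewrite opprB addrA subrK.
apply: (psi2_leD (X := fun w => - (X (t i) w - X (u i) w))).
- by apply: measurableT_comp => //; apply: measurable_funB; exact: mX.
- by apply: measurable_funB; exact: mX.
- by apply: psi2_leN; apply: tu; rewrite ltrDl.
- by apply: tv; rewrite ltrDl.
Qed.

Lemma d_psi2_refl t : T t -> fine (d_psi2 X t t) = 0.
Proof.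
move=> Tt; apply/eqP; rewrite eq_le dist_ge0 andbT.
apply/ler_addgt0Pr => e e0; rewrite add0r; apply: psi2_le_dist => // i; split; first exact: e0.
under eq_integral do rewrite subrr expr0n/= mul0r expR0.
rewrite integral_cst// mul1e [leLHS](@probability_setT _ _ _ (P i)).
by rewrite lee_fin; lra.
Qed.

Lemma radius_psi2_ge0 : (0 <= radius_psi2 X T)%E.
Proof.
have [t Tt] := T0; apply: le_ereal_sup_tmp; eexists; first by exists t.
apply: (@le_trans _ _ (psi2_norm (P (Ordinal m0)) (X (t _)))).
  exact: psi2_norm_ge0.
exact: (@Order.TotalTheory.le_bigmax _ _ _ _
  (fun i => psi2_norm (P i) (X (t i)))).
Qed.

Lemma radius_psi2_fin : radius_psi2 X T \is a fin_num.
Proof.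
have [n [e [Te eT]]] := finite_enum fT T0.
pose r t := \big[maxe/-oo%E]_(i < m) psi2_norm (P i) (X (t i)).
have r0 t : (0 <= r t)%E.
  apply: (@le_trans _ _ (psi2_norm (P (Ordinal m0)) (X (t _)))).
    exact: psi2_norm_ge0.
  exact: (@Order.TotalTheory.le_bigmax _ _ _ _ (fun i => psi2_norm (P i) (X (t i)))).
have roo t : T t -> (r t < +oo)%E.
  move=> Tt; apply: bigmax_lt => [|i _]; first by [].
  exact: sgT.
rewrite ge0_fin_numE ?radius_psi2_ge0//.
apply: (@le_lt_trans _ _ (\sum_(a < n) r (e a))%E); last first.
  by apply: lte_sum_pinfty => a _; exact: roo.
apply/ereal_supP => _ [t Tt <-]; have [a <-] := eT _ Tt.
by rewrite (bigD1 a)//= leeDl// sume_ge0.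
Qed.

Lemma radius_psi2_le b : fine (radius_psi2 X T) < b ->
  forall t, T t -> psi2_radius_le X t b.
Proof.
move=> Tb t Tt i; apply: psi2_norm_lt; first exact: mX.
apply: (@le_lt_trans _ _ (radius_psi2 X T)); last first.
  by rewrite -(fineK radius_psi2_fin) lte_fin.
apply: le_ereal_sup_tmp; exists (\big[maxe/-oo%E]_(i < m) psi2_norm (P i) (X (t i))).
  by exists t.
exact: (@Order.TotalTheory.le_bigmax _ _ _ _ (fun i => psi2_norm (P i) (X (t i)))).
Qed.

Lemma set_dist_approx t (A : set (forall i, S i)) (delta : R) :
  T t -> A `<=` T -> A !=set0 -> 0 < delta ->
  set_dist (d_psi2 X) t A \is a fin_num /\
  exists2 s, A s & fine (d_psi2 X t s) <= fine (set_dist (d_psi2 X) t A) + delta.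
Proof.
move=> Tt AT [s As] del0.
have dfin : set_dist (d_psi2 X) t A \is a fin_num.
  rewrite ge0_fin_numE; last first.
    by apply/ereal_infP => _ [x _ <-]; exact: d_psi2_ge0.
  apply: (@le_lt_trans _ _ (d_psi2 X t s)).
    by apply: ereal_inf_lbound; exists s.
  by have := d_psi2_fin Tt (AT _ As); rewrite ge0_fin_numE ?d_psi2_ge0.
split => //; have [_ [x Ax <-] xd] := lb_ereal_inf_adherent del0 dfin.
exists x => //; rewrite -lee_fin EFinD !fineK ?d_psi2_fin//; last exact: AT.
exact: ltW.
Qed.

(* The admissible sequence is truncated: from a level [N] on at which
   [2 ^ (2 ^ N)] exceeds the cardinal of [T] it is replaced by [T] itself.
   The slack [delta] makes the metric positive and absorbs the infima. *)
Lemma chain_exists (l : nat) (eps g : R) : 0 < eps ->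
  gamma2_from l T (d_psi2 X) = g%:E ->
  exists N (e : forall n, 'I_(2 ^ (2 ^ n)) -> forall i, S i)
    (D : (forall i, S i) -> (forall i, S i) -> R),
  [/\ (l <= N)%N,
      (forall u v, 0 < D u v),
      (forall t u v, T t -> T u -> T v -> D u v <= D t u + D t v),
      (forall u v, T u -> T v -> psi2_dist_le X u v (D u v)) &
      (forall n a, T (e n a)) /\
      (forall t, T t -> exists2 j : forall n, 'I_(2 ^ (2 ^ n)), e N (j N) = t &
       \sum_(l <= n < N.+1) root2 R n * D t (e n (j n)) <= g + 2 * eps)].
Proof.
move=> eps0 gE.
have gfin : gamma2_from l T (d_psi2 X) \is a fin_num by rewrite gE.
have [_ [Tn [TnT Tn0 Tn1 Tncard] <-]] := lb_ereal_inf_adherent eps0 gfin.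
rewrite -/(gamma2_from l T (d_psi2 X)) gE -EFinD => supTn.
have [M TM] : exists M, (T #<= `I_M)%card.
  by have /finite_setP[M /card_eqPle[TM _]] := fT; exists M.
pose N := maxn l M.
have lN : (l <= N)%N by rewrite leq_maxl.
have TN n : (N <= n)%N -> (T #<= `I_(2 ^ (2 ^ n)))%card.
  move=> Nn; apply: (card_le_trans TM); rewrite card_le_II.
  apply: (@leq_trans n); first by rewrite (leq_trans _ Nn)// leq_maxr.
  by apply: (@leq_trans (2 ^ n)); rewrite ltnW// ltn_expl.
pose A n := if (n < N)%N then Tn n else T.
have AT n : A n `<=` T by rewrite /A; case: ifP => _; [exact: TnT|].
have A0 n : A n !=set0 by rewrite /A; case: ifP => _; [exact: Tn0|].
have Acard n : (A n #<= `I_(2 ^ (2 ^ n)))%card.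
  rewrite /A; case: ifP => [_|/negbT]; last by rewrite -leqNgt; exact: TN.
  case: n => [|n]; last exact: Tncard.
  have /card_eqPle[h _] := Tn1; apply: (card_le_trans h).
  by rewrite card_le_II.
have eA n : exists e : 'I_(2 ^ (2 ^ n)) -> forall i, S i,
    (forall a, A n (e a)) /\ (forall x, A n x -> exists a, e a = x).
  by have [x Ax] := A0 n; exact: card_le_enum (Acard n) Ax.
pose e n := sval (cid (eA n)).
have [eT eS] : (forall n a, A n (e n a)) /\
    (forall n x, A n x -> exists a, e n a = x).
  by split=> n; case: (svalP (cid (eA n))).
(* A level below [N] loses [delta] in approximating the infimum and [delta] in the definition of
   [D]. Weighted by [root2] these losses total at most [2 * delta * rho = eps]; the other [eps]
   comes from the choice of the admissible sequence. *)
pose rho := 1 + \sum_(0 <= n < N.+1) root2 R n.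
have rho0 : 0 < rho.
  by rewrite ltr_pwDl// sumr_ge0// => n _; exact: ltW (root2_gt0 _ _).
pose delta := eps / (2 * rho).
have del0 : 0 < delta by rewrite divr_gt0// mulr_gt0.
pose D u v := dist u v + delta.
exists N, e, D; split => //.
- by move=> u v; rewrite ltr_pwDr.
- move=> t u v Tt Tu Tv; rewrite /D [leRHS]addrACA.
  by apply: lerD; [exact: d_psi2_triangle|rewrite lerDl ltW].
- by move=> u v Tu Tv; apply: dist_psi2_le => //; rewrite ltrDl.
split; first by move=> n a; apply: (@AT n); exact: eT.
move=> t Tt.
pose sd n := fine (set_dist (d_psi2 X) t (Tn n)).
have jE n : exists a, ((n < N)%N -> dist t (e n a) <= sd n + delta) /\
    ((N <= n)%N -> e n a = t).
  have [nN|Nn] := ltnP n N.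
    have [_ [s As sle]] := set_dist_approx Tt (TnT n) (Tn0 n) del0.
    have [a eas] : exists a, e n a = s by apply: eS; rewrite /A nN.
    by exists a; split=> [_|/notF[]]; rewrite eas; exact: sle.
  have [a eat] : exists a, e n a = t by apply: eS; rewrite /A ltnNge Nn.
  by exists a.
pose j n := sval (cid (jE n)).
have [jP jN'] : (forall n, (n < N)%N -> dist t (e n (j n)) <= sd n + delta) /\
    (forall n, (N <= n)%N -> e n (j n) = t).
  by split=> n; case: (svalP (cid (jE n))).
have jN : e N (j N) = t by exact: jN'.
exists j; first exact: jN.
have hsd : \sum_(l <= n < N) root2 R n * sd n <= g + eps.
  rewrite -lee_fin; apply: le_trans (ltW supTn).
  apply: le_ereal_sup_tmp; eexists; first by exists t.
  apply: le_trans (nneseries_lim_ge N _); last first.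
    move=> n _ _; apply: mule_ge0; first by rewrite lee_fin powR_ge0.
    by apply/ereal_infP => _ [x _ <-]; exact: d_psi2_ge0.
  rewrite -sumEFin; apply: lee_sum => n _; rewrite EFinM fineK//.
  exact: (set_dist_approx Tt (TnT n) (Tn0 n) del0).1.
have hr : \sum_(l <= n < N.+1) root2 R n <= rho.
  rewrite /rho (big_cat_nat (leq0n l) (leqW lN))/= addrA lerDr.
  by rewrite addr_ge0// sumr_ge0// => n _; exact: ltW (root2_gt0 _ _).
have hD : delta * rho = eps / 2 by rewrite /delta; field; rewrite gt_eqF.
rewrite (big_nat_recr _ _ _ lN)/= jN /D /dist d_psi2_refl// add0r.
have h1 : \sum_(l <= n < N) root2 R n * (fine (d_psi2 X t (e n (j n))) + delta) <=
   \sum_(l <= n < N) root2 R n * sd n + 2 * delta * \sum_(l <= n < N) root2 R n.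
  rewrite mulr_sumr -big_split/= !big_nat; apply: ler_sum => n /andP[_ nN].
  rewrite [_ * root2 R n]mulrC -mulrDr; apply: ler_wpM2l; first exact: ltW (root2_gt0 R n).
  rewrite mulr_natl mulr2n addrA lerD2r; exact: jP.
have h2 : 2 * delta * \sum_(l <= n < N) root2 R n + root2 R N * delta <= 2 * delta * rho.
  have key (x r dl rh : R) : 0 < r -> 0 < dl -> x + r <= rh ->
      2 * dl * x + r * dl <= 2 * dl * rh by nra.
  apply: key => //; first exact: root2_gt0.
  by move: hr; rewrite (big_nat_recr _ _ _ lN).
lra.
Qed.
End index_set.
End psi2_metric.

(** * Removal of the slack, and the tail bound *)

(** With [l] the integer part of the binary logarithm, [p] lies between [2^l] and [2^(l+1)], and
    [chain_exp l] is [8 * 2^l]. The lower bound allows p-th roots of the weight from level [l] on;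
    the upper one keeps the starting term of the right order in [p]. *)
Lemma chain_exp_log (R : realType) (p : R) : 1 <= p ->
  p <= (chain_exp (Num.truncn (ln p / ln 2)))%:R <= 8 * p.
Proof.
move=> p1; have p0 : 0 < p by apply: lt_le_trans p1.
have l20 : 0 < ln 2 :> R by rewrite ln_gt0// ltr1n.
have x0 : 0 <= ln p / ln 2 by apply: divr_ge0; [exact: ln_ge0|exact: ltW].
have /andP[] := truncn_itv x0; set l := Num.truncn _.
rewrite ler_pdivlMr// ltr_pdivrMr// => lp pl.
have e2 k : expR (k%:R * ln 2) = 2 ^+ k :> R.
  by rewrite mulrC expRM_natr lnK// posrE.
have h1 : 2 ^+ l <= p by rewrite -e2 -[leRHS](lnK (x := p)) ?posrE// ler_expR.
have h2 : p <= 2 ^+ l.+1 by rewrite -e2 -[leLHS](lnK (x := p)) ?posrE// ler_expR ltW.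
rewrite /chain_exp natrX; move: h2; rewrite !exprS mulrA mulrA.
move: (2 ^+ l) h1 => x h1 h2; by apply/andP; split; lra.
Qed.

(** Since [eps], [1 / m] and [1 / sqrt m] are at most 1, the error is linear in [eps]: [4 * gam + 4]
    from the square and [2 * b + gam + 2] from the product. The tail terms absorb it at the price of
    the factor 2. *)
Lemma chaining_bound_slack (R : realType) (m : nat) (b sigma K p gam eps : R) :
  (0 < m)%N -> 0 <= b -> 0 <= gam -> 0 < eps -> eps <= 1 ->
  eps * (5 * gam + 2 * b + 6) <=
    Num.sqrt p * (sigma / Num.sqrt m%:R) + p * (K / m%:R) ->
  chaining_bound m (b + eps) sigma K p (gam + 2 * eps) <=
  2 * chaining_bound m b sigma K p gam.
Proof.
move=> m0 b0 g0 e0 e1; rewrite /chaining_bound.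
have m1 : 1 <= m%:R :> R by rewrite ler1n.
have i0 : 0 <= m%:R^-1 :> R by rewrite invr_ge0.
have i1 : m%:R^-1 <= 1 :> R by rewrite invf_le1// ltr0n.
have r0 : 0 <= (Num.sqrt m%:R)^-1 :> R by rewrite invr_ge0 sqrtr_ge0.
have r1 : (Num.sqrt m%:R)^-1 <= 1 :> R.
  rewrite invf_le1 ?sqrtr_gt0 ?ltr0n//.
  by rewrite -[leLHS]sqrtr1 ler_wsqrtr.
move: (m%:R^-1) (Num.sqrt m%:R)^-1 i0 i1 r0 r1 => i r i0 i1 r0 r1.
move: (Num.sqrt p * _) (p * _) => y z h.
have h1 : (gam + 2 * eps) ^+ 2 * i <= gam ^+ 2 * i + (4 * gam * eps + 4 * eps).
  have -> : (gam + 2 * eps) ^+ 2 * i = gam ^+ 2 * i + (4 * gam * eps + 4 * eps ^+ 2) * i by ring.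
  rewrite lerD2l; have a0 : 0 <= 4 * gam * eps by rewrite !mulr_ge0// ltW.
  have b1 : 0 <= eps ^+ 2 <= eps by rewrite sqr_ge0/= expr2 ger_pMr.
  by case/andP: b1 => b1 b2; nra.
have h2 : (b + eps) * (gam + 2 * eps) * r <= b * gam * r + (2 * b * eps + eps * gam + 2 * eps).
  have -> : (b + eps) * (gam + 2 * eps) * r =
    b * gam * r + (2 * b * eps + eps * gam + 2 * eps ^+ 2) * r by ring.
  rewrite lerD2l; have a0 : 0 <= 2 * b * eps by rewrite !mulr_ge0// ltW.
  have a1 : 0 <= eps * gam by rewrite !mulr_ge0// ltW.
  have b1 : 0 <= eps ^+ 2 <= eps by rewrite sqr_ge0/= expr2 ger_pMr.
  by case/andP: b1 => b1 b2; nra.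
have h3 : 0 <= gam ^+ 2 * i by rewrite mulr_ge0 ?sqr_ge0.
have h4 : 0 <= b * gam * r by rewrite !mulr_ge0.
by move: h1 h2 h3 h4 h; nra.
Qed.

Lemma gamma2_from_ge0 (R : realType) (U : Type) (l : nat) (T : set U)
    (d : U -> U -> \bar R) : T !=set0 -> (forall u v, 0 <= d u v)%E ->
  (0 <= gamma2_from l T d)%E.
Proof.
move=> [t Tt] d0; apply/ereal_infP => _ [Tn _ <-].
apply: le_ereal_sup_tmp; eexists; first by exists t.
apply: nneseries_ge0 => n _ _; apply: mule_ge0; first by rewrite lee_fin powR_ge0.
by apply/ereal_infP => _ [s _ <-].
Qed.

Lemma gamma2p_le (R : realType) (U : Type) (p : R) (T : set U)
    (d : U -> U -> \bar R) : (forall u v, 0 <= d u v)%E ->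
  (gamma2p p T d <= gamma2 T d)%E.
Proof.
move=> d0; rewrite /gamma2p /gamma2 /gamma2_from; set l := Num.truncn _.
apply/ereal_infP => _ [Tn aTn <-]; apply: ge_ereal_inf; eexists; first by exists Tn.
apply/ereal_supP => _ [t Tt <-]; apply: le_ereal_sup_tmp; eexists; first by exists t.
have u0 n : (0 <= (2 `^ (n%:R / 2))%:E * set_dist d t (Tn n))%E.
  apply: mule_ge0; first by rewrite lee_fin powR_ge0.
  by apply/ereal_infP => _ [s _ <-].
apply: nneseries_le_ub => // n.
apply: (@le_trans _ _ (\sum_(0 <= i < n) (2 `^ (i%:R / 2))%:E * set_dist d t (Tn i))%E).
  have [ln|nl] := leqP l n; last first.
    by rewrite big_geq ?sume_ge0// ltnW.
  by rewrite [leRHS](big_cat_nat (leq0n l) ln)/= leeDr// sume_ge0.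
exact: nneseries_lim_ge.
Qed.

(** Markov's inequality for the p-th power: at [e] times the moment bound the ratio of p-th powers
    is [e^-p]. *)
Lemma markov_powR (R : realType) d (T : measurableType d) (Q : probability T R)
    (f : T -> R) (p c : R) : measurable_fun setT f -> (forall w, 0 <= f w) ->
  0 < p -> 0 < c -> (\int[Q]_w (f w `^ p)%:E <= (c `^ p)%:E)%E ->
  (Q [set w | (expR 1 * c <= f w)%R] <= (expR (- p))%:E)%E.
Proof.
move=> mf f0 p0 c0 fc.
set A := [set w | _].
have mA : measurable A.
  rewrite -[A]setTI.
  rewrite (_ : A = f @^-1` `[expR 1 * c, +oo[%classic); first exact: mf.
  by apply/seteqP; split=> w; rewrite /A /= in_itv/= andbT.
have ec0 : 0 < expR 1 * c by rewrite mulr_gt0 ?expR_gt0.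
have mp : measurable_fun setT (fun w => (f w `^ p)%:E).
  apply/measurable_EFinP; apply: (measurableT_comp (f := fun x : R => x `^ p)) => //.
have h : (((expR 1 * c) `^ p)%:E * Q A <= (c `^ p)%:E)%E.
  apply: le_trans fc; rewrite -integral_cst; last exact: mA.
  apply: (@le_trans _ _ (\int[Q]_(w in A) (f w `^ p)%:E)%E).
    apply: ge0_le_integral => //.
    - by move=> w _; rewrite lee_fin powR_ge0.
    - exact: measurable_funS mp.
    move=> w Aw; rewrite lee_fin ge0_ler_powR ?nnegrE// ltW//.
  by apply: ge0_subset_integral => // w _; rewrite lee_fin powR_ge0.
move: h; rewrite powRM ?expR_ge0 ?(ltW c0)// -expRM mul1r.
have QA : Q A \is a fin_num by exact: fin_num_measure.
rewrite -(fineK QA) -EFinM !lee_fin expRN.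
have cp : 0 < c `^ p by exact: powR_gt0.
rewrite -mulrA mulrCA ger_pMr// => h.
by rewrite -[leRHS]mulr1 ler_pdivlMl ?expR_gt0.
Qed.

(* Kept as a product: a single large numeral would be expanded to a unary number. *)
Definition chaining_const (R : realType) : R := 3 * (2400 * (256 * 2)).

Lemma chaining_const_gt0 (R : realType) : 0 < chaining_const R.
Proof. by rewrite /chaining_const; do !(apply: mulr_gt0; first by rewrite ltr0n). Qed.

Lemma sup_moment_le (R : realType) (m : nat) (d : 'I_m -> measure_display)
    (Omega : forall i, measurableType (d i))
    (P : forall i, probability (Omega i) R)
    (Q : probability (dprod Omega) R)
    (S : 'I_m -> Type) (X : forall i, S i -> {RV (P i) >-> R})
    (T : set (forall i, S i)) (sigma K p g : R) :
  (0 < m)%N -> is_product_probability P Q -> finite_set T -> T !=set0 ->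
  (forall t, T t -> forall i, subgaussian (P i) (X i (t i))) ->
  0 < sigma -> 0 < K -> 1 <= p ->
  (forall t k, T t -> (avg_moment X k.+2 t <=
    (k.+2`!%:R / 2 * sigma ^+ 2 * K ^+ k)%:E)%E) ->
  gamma2p p T (d_psi2 X) = g%:E ->
  (\int[Q]_w (sup [set `|avg_centered_square X t w| `^ p | t in T])%:E <=
    ((chaining_const R *
      chaining_bound m (fine (radius_psi2 X T)) sigma K p g) `^ p)%:E)%E.
Proof.
move=> m0 PQ fT T0 sgT sigma0 K0 p1 mom gE.
have p0 : 0 < p by apply: lt_le_trans p1.
set b := fine (radius_psi2 X T).
have b0 : 0 <= b by apply: fine_ge0; exact: radius_psi2_ge0.
have g0 : 0 <= g.
  by rewrite -lee_fin -gE; apply: gamma2_from_ge0 => // u v; exact: d_psi2_ge0.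
pose s := Num.sqrt p * (sigma / Num.sqrt m%:R) + p * (K / m%:R).
have s0 : 0 < s.
  rewrite /s addr_gt0// mulr_gt0// ?sqrtr_gt0// divr_gt0// ?sqrtr_gt0 ltr0n//.
pose D := 5 * g + 2 * b + 6.
have D0 : 0 < D by rewrite ltr_pwDr ?ltr0n// addr_ge0// mulr_ge0.
(* Chosen to satisfy both smallness conditions of [chaining_bound_slack]. *)
pose eps := Num.min 1 (s / D).
have e0 : 0 < eps by rewrite lt_min ltr01 divr_gt0.
have e1 : eps <= 1 by rewrite ge_min lexx.
have eD : eps * D <= s by rewrite -ler_pdivlMr// ge_min lexx orbT.
have [N [e [D' [lN D'0 tri TD [eT cover]]]]] := chain_exists m0 fT T0 sgT e0 gE.
have /andP[lp pl] := chain_exp_log p1.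
have Tb : forall t, T t -> psi2_radius_le X t (b + eps).
  by apply: (radius_psi2_le m0 fT T0 sgT); rewrite ltrDl.
have be0 : 0 < b + eps by rewrite ltr_wpDl.
have h := chaining_moment m0 PQ fT T0 lN be0 sigma0 K0 p1 lp pl D'0 tri Tb TD eT cover mom.
apply: (le_trans h); rewrite lee_fin.
have slack := chaining_bound_slack m0 b0 g0 e0 e1 eD.
have pos := chaining_bound_gt0 m0 T0 be0 sigma0 K0 p1 D'0 cover.
move: slack pos; rewrite /chaining_const.
move: (chaining_bound m (b + eps) _ _ _ _) (chaining_bound m b _ _ _ _) => x y xy xpos.
have x2 : 0 <= 2400 * (256 * x).
  by do 2!(apply: mulr_ge0; first exact: ler0n); exact: ltW.
(* The mean 3 of the weight moves inside the power, since [p >= 1] gives [3 <= 3 ^ p]. *)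
apply: (@le_trans _ _ ((3 * (2400 * (256 * x))) `^ p)).
  move: (2400 * (256 * x)) x2 => z z0; have three0 : 0 <= 3 :> R by rewrite ler0n.
  rewrite (powRM _ three0 z0); apply: ler_wpM2r; first exact: powR_ge0.
  by rewrite -[leLHS](powRr1 three0) ler_powR// ler1n.
apply: ge0_ler_powR; rewrite ?nnegrE.
- exact: ltW.
- by apply: mulr_ge0; first exact: ler0n.
- apply: mulr_ge0; last by move: xy xpos; lra.
  by do !(apply: mulr_ge0; first exact: ler0n); exact: ler0n.
rewrite -!mulrA; do 3!(apply: ler_wpM2l; first exact: ler0n).
exact: xy.
Qed.

Theorem theorem5p5 (R : realType) :
  exists c C C' : R, [/\ 0 < c, 0 < C & 0 < C'] /\
  forall (m : nat) (d : 'I_m -> measure_display)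
    (Omega : forall i : 'I_m, measurableType (d i))
    (P : forall i : 'I_m, probability (Omega i) R)
    (S : 'I_m -> Type) (T : set (forall i : 'I_m, S i))
    (X : forall i : 'I_m, S i -> {RV (P i) >-> R})
    (sigma K : R),
  (0 < m)%N ->
  finite_set T ->
  T !=set0 ->
  (forall t, T t -> forall i, subgaussian (P i) (X i (t i))) ->
  0 < sigma ->
  0 < K ->
  (forall q : nat, (2 <= q)%N ->
    (ereal_sup [set avg_moment X q t | t in T] <=
     (q`!%:R / 2 * sigma ^+ 2 * K ^+ (q - 2))%:E)%E) ->
  let A := avg_centered_square X in
  let Prod := product_probability P in
  let Delta := radius_psi2 X T in
  let sqrtm := Num.sqrt (m%:R : R) in
  (forall p : R, 1 <= p ->
    let gamma := gamma2p p T (d_psi2 X) in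
    (poweR 'E_Prod[(fun w => sup [set `|A t w| `^ p | t in T])%R] (p^-1)%R <=
     C'%:E * ((m%:R^-1)%:E * gamma ^+ 2
              + (sqrtm^-1)%:E * Delta * gamma
              + (Num.sqrt p * (sigma / sqrtm))%:E
              + (p * (K / m%:R))%:E))%E) /\
  (forall u : R, 1 <= u ->
    let gamma := gamma2 T (d_psi2 X) in
    (Prod [set w |
       C%:E * ((m%:R^-1)%:E * gamma ^+ 2 + Delta * (sqrtm^-1)%:E * gamma)
       + c%:E * ((Num.sqrt u * (sigma / sqrtm))%:E + (u * (K / m%:R))%:E)
       <= (sup [set `|A t w| | t in T]%R)%:E]
     <= (expR (- u))%:E)%E).
Proof.
have C0 := chaining_const_gt0 R; have e0 := expR_gt0 (1 : R).
(* The tail constants are [e] times the moment constant, the level at which [markov_powR] yields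
   [e^-u]. *)
exists (expR 1 * chaining_const R), (expR 1 * chaining_const R), (chaining_const R).
split; first by split=> //; exact: mulr_gt0.
move=> m d Omega P S T X sigma K m0 fT T0 sgT sigma0 K0 mom A Prod Delta sqrtm.
have PQ : is_product_probability P Prod := product_probabilityP P.
have mom' t k : T t -> (avg_moment X k.+2 t <=
    (k.+2`!%:R / 2 * sigma ^+ 2 * K ^+ k)%:E)%E.
  move=> Tt; have := mom k.+2 isT; rewrite subn2/=; apply: le_trans.
  by apply: ereal_sup_ubound; exists t.
pose b := fine Delta.
have DeltaE : Delta = b%:E by rewrite fineK// radius_psi2_fin.
have Delta0 : 0 <= b by apply: fine_ge0; exact: radius_psi2_ge0.
have mR0 : 0 < m%:R :> R by rewrite ltr0n.
have sm0 : 0 < sqrtm by rewrite sqrtr_gt0.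
have mom_le p g : 1 <= p -> gamma2p p T (d_psi2 X) = g%:E ->
    (\int[Prod]_w (sup [set `|A t w| `^ p | t in T])%:E <=
    ((chaining_const R * chaining_bound m (b) sigma K p g) `^ p)%:E)%E.
  by move=> p1 gE; apply: sup_moment_le gE.
have d0 u v : (0 <= d_psi2 X u v)%E by exact: d_psi2_ge0.
have tail0 p : 1 <= p -> 0 < Num.sqrt p * (sigma / sqrtm) + p * (K / m%:R).
  move=> p1; have p0 := lt_le_trans ltr01 p1.
  by apply: addr_gt0; apply: mulr_gt0; rewrite ?sqrtr_gt0// divr_gt0.
have boundE p g : chaining_bound m (b) sigma K p g =
    m%:R^-1 * g ^+ 2 + sqrtm^-1 * b * g
    + Num.sqrt p * (sigma / sqrtm) + p * (K / m%:R).
  by rewrite /chaining_bound -/sqrtm [_ / m%:R]mulrC; congr (_ + _ + _ + _); ring.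
have bound0 p g : 1 <= p -> 0 <= g -> 0 < chaining_bound m (b) sigma K p g.
  move=> p1 g0; rewrite boundE -addrA; apply: ltr_wpDl; last exact: tail0.
  by apply: addr_ge0; rewrite !mulr_ge0 ?invr_ge0 ?sqr_ge0 ?(ltW sm0).
have gamma0 l : (0 <= gamma2_from l T (d_psi2 X))%E by exact: gamma2_from_ge0.
(* Covers [gamma = +oo]. The first term alone is infinite, and the second is nonnegative even for
   [z = 0], where the product is 0. *)
have infinite (z : \bar R) : (0 <= z)%E ->
    ((m%:R^-1)%:E * +oo ^+ 2 + z * +oo = +oo)%E.
  move=> z0; rewrite (_ : +oo ^+ 2 = +oo)%E; last by rewrite expe2 mulyy.
  rewrite gt0_muley ?lte_fin ?invr_gt0// addye// -ltNye.
  by apply: (@lt_le_trans _ _ 0%E) => //; rewrite mule_ge0// leey.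
split.
  move=> p p1; cbv zeta; set gamma := gamma2p p T (d_psi2 X).
  have p0 : 0 < p := lt_le_trans ltr01 p1.
  have gamma_ge0 : (0 <= gamma)%E by exact: gamma0.
  case gE : gamma gamma_ge0 => [g| |]; last by [].
    rewrite lee_fin => g0.
    have hb := mom_le _ _ p1 gE.
    have c0 : 0 < chaining_const R * chaining_bound m (b) sigma K p g.
      by apply: mulr_gt0; [exact: C0|exact: bound0].
    have -> : ((chaining_const R)%:E * ((m%:R^-1)%:E * g%:E ^+ 2 +
        (sqrtm^-1)%:E * Delta * g%:E + (Num.sqrt p * (sigma / sqrtm))%:E +
        (p * (K / m%:R))%:E) =
        (chaining_const R * chaining_bound m (b) sigma K p g)%:E)%E.
      by rewrite DeltaE -EFin_expe -!EFinM boundE.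
    rewrite expectation.unlock.
    have I0 : (0 <= \int[Prod]_w (sup [set `|A t w| `^ p | t in T])%:E)%E.
      apply: integral_ge0 => w _; rewrite lee_fin; have [t Tt] := T0.
      apply: le_trans (sup_finite_ge (fun t => `|A t w| `^ p) fT Tt).
      exact: powR_ge0.
    have pi0 : 0 <= p^-1 by rewrite invr_ge0 ltW.
    apply: le_trans (gt0_ler_poweR pi0 _ _ hb) _.
    - by rewrite in_itv/= I0 leey.
    - by rewrite in_itv/= lee_fin powR_ge0 leey.
    by rewrite poweR_EFin lee_fin -powRrM mulfV ?gt_eqF// powRr1// ltW.
  move=> _; rewrite infinite; last first.
    by rewrite DeltaE -EFinM lee_fin mulr_ge0// invr_ge0 ltW.
  by rewrite !addye// gt0_muley ?lte_fin// leey.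
move=> u u1; cbv zeta; set gamma := gamma2 T (d_psi2 X).
have u0 : 0 < u := lt_le_trans ltr01 u1.
have gamma_ge0 : (0 <= gamma)%E by exact: gamma0.
set A_tail := [set w | _].
case gE : gamma gamma_ge0 => [g| |]; last by [].
  rewrite lee_fin => g0.
  (* The moment bound at [p = u] involves [gamma2p u]; the tail is stated with the larger
     [gamma2]. *)
  have gp_le : (gamma2p u T (d_psi2 X) <= g%:E)%E by rewrite -gE; exact: gamma2p_le.
  have gp_ge0 : (0 <= gamma2p u T (d_psi2 X))%E by exact: gamma0.
  case hE : (gamma2p u T (d_psi2 X)) gp_le gp_ge0 => [h| |]//.
  rewrite !lee_fin => hg h0.
  pose f w := sup [set `|A t w| | t in T].
  have f0 w : 0 <= f w.
    by have [t Tt] := T0; apply: le_trans (sup_finite_ge (fun t => `|A t w|) fT Tt).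
  have mf : measurable_fun setT f.
    apply: measurable_finite_sup => // t; apply: measurableT_comp => //.
    exact: measurable_avg_centered_square.
  (* The supremum over the finite [T] is attained, so it commutes with the power. *)
  have fE w : f w `^ u = sup [set `|A t w| `^ u | t in T].
    apply/eqP; rewrite eq_le; apply/andP; split.
      have [t Tt st] := sup_finite_attained (fun t => `|A t w|) fT T0; rewrite /f st.
      exact: (sup_finite_ge (fun t => `|A t w| `^ u) fT Tt).
    apply: sup_finite_le => // t Tt; apply: ge0_ler_powR; rewrite ?nnegrE//.
      exact: ltW.
    exact: (sup_finite_ge (fun t => `|A t w|) fT Tt).
  pose c := chaining_const R * chaining_bound m (b) sigma K u g.
  have c0 : 0 < c by apply: mulr_gt0; [exact: C0|exact: bound0].
  have hc : (\int[Prod]_w (f w `^ u)%:E <= (c `^ u)%:E)%E.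
    under eq_integral do rewrite fE.
    apply: le_trans (mom_le _ _ u1 hE) _; rewrite lee_fin.
    have b_h : 0 < chaining_const R * chaining_bound m (b) sigma K u h.
      by apply: mulr_gt0; [exact: C0|exact: bound0].
    apply: ge0_ler_powR; rewrite ?nnegrE ?(ltW u0) ?(ltW b_h) ?(ltW c0)//.
    apply: ler_wpM2l; first exact: ltW.
    rewrite !boundE !lerD2r; apply: lerD; apply: ler_wpM2l; rewrite ?invr_ge0//.
      by rewrite ler_pXn2r.
    by rewrite mulr_ge0// invr_ge0 ltW.
  have -> : A_tail = [set w | expR 1 * c <= f w].
    apply/seteqP; split=> w; rewrite /A_tail /mkset;
      rewrite gE DeltaE -EFin_expe -!EFinM lee_fin;
      rewrite -/(f w) /c boundE;
      move=> hw; apply: le_trans hw; rewrite le_eqVlt; apply/orP; left; apply/eqP; ring.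
  exact: markov_powR.
move=> _.
(* With infinite [gamma] the threshold is [+oo], out of reach of a real supremum. *)
have -> : A_tail = set0.
  apply/seteqP; split=> w //; rewrite /A_tail /mkset gE infinite; last first.
    by rewrite DeltaE -EFinM lee_fin mulr_ge0// invr_ge0 ltW.
  have ec : 0 < expR 1 * chaining_const R by exact: mulr_gt0.
  by rewrite gt0_muley ?lte_fin// -EFinD -EFinM addye// leye_eq.
by rewrite [leLHS](_ : _ = 0%E) ?lee_fin ?expR_ge0//; exact: measure0.
Qed.
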